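(* Given a generalised triangulation $\mathfrak{T}$ of a closed 3-manifold, and an integer $r\ge 3$, an admissible colouring of the edges of $\mathfrak{T}$ with $r-1$ colours corresponds to a system of normal arcs in the 2-skeleton of $\mathfrak{T}$ with at most $r-2$ arcs per triangle, forming a collection of cycles on the boundary of each tetrahedron of $\mathfrak{T}$.
   Context: A generalised triangulation $\mathfrak{T}$ of a closed 3-manifold $M$ is a collection of $n$ abstract tetrahedra whose $4n$ triangular faces are identified (''glued'') in pairs by affine maps so that the underlying topological space is homeomorphic to $M$; several vertices, edges or faces of the same tetrahedron may become identified. The equivalence classes of tetrahedron vertices, edges, triangles under the gluings are called the vertices, edges, triangles of $\mathfrak{T}$; $E$ is the set of edges. A colouring is a map $\theta:E\to I$, where $I=\{0,\tfrac12,1,\dots,\tfrac{r-2}{2}\}$ is the set of $r-1$ colours. It is admissible if for each triangle of $\mathfrak{T}$ with bounding edges $e_1,e_2,e_3$: (parity condition) $\theta(e_1)+\theta(e_2)+\theta(e_3)\in\mathbb{Z}$; (triangle inequalities) $\theta(e_a)\le\theta(e_b)+\theta(e_c)$ for all $\{a,b,c\}=\{1,2,3\}$; (upper bound constraint) $\theta(e_1)+\theta(e_2)+\theta(e_3)\le r-2$. Normal arcs are straight lines in the interior of a triangle which are pairwise disjoint and meet the edges of the triangle, but not its vertices. A system of normal arcs in the 2-skeleton consists of normal arcs in the triangles of $\mathfrak{T}$; on the boundary of a tetrahedron it forms a collection of cycles if the arcs in its four faces join up along the edges into closed curves. In the paper's construction the integer $\phi(e)=2\theta(e)\in\{0,1,\dots,r-2\}$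 is interpreted as the number of intersections of normal arcs with the edge $e$. *)

(* Defs.v *)
From HB Require Import structures.
From Stdlib Require Import Relation_Operators.
From mathcomp Require Import all_boot all_order all_algebra all_fingroup.
From mathcomp Require Import all_classical all_reals all_analysis.

Set Implicit Arguments.
Unset Strict Implicit.
Unset Printing Implicit Defensive.

Import Order.TTheory GRing.Theory Num.Theory.
Import numFieldNormedType.Exports.

Local Open Scope classical_set_scope.
Local Open Scope card_scope.
Local Open Scope quotient_scope.
Local Open Scope ring_scope.

Definition equiv_closure (X : Type) (r : X -> X -> Prop) : rel X :=
  fun x y => `[< clos_refl_sym_trans X r x y >].

Lemma equiv_closureP (X : Type) (r : X -> X -> Prop) :
  equiv_class_of (equiv_closure r).
Proof.
split=> [x|x y|y x z].
- by apply/asboolP; exact: rst_refl.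
- by apply/asboolP/asboolP; exact: rst_sym.
- move=> /asboolP xy /asboolP yz; apply/asboolP; exact: rst_trans xy yz.
Qed.

Canonical equiv_closure_equiv (X : Type) (r : X -> X -> Prop) : equiv_rel X :=
  EquivRelPack (equiv_closureP r).

Definition homeomorphic (X Y : topologicalType) : Prop :=
  exists (f : X -> Y) (g : Y -> X),
    [/\ continuous f, continuous g, cancel f g & cancel g f].

(* Not required to be connected. *)
Definition closed_manifold (R : realType) (d : nat) (M : topologicalType) :
    Prop :=
  [/\ hausdorff_space M, @second_countable M, compact [set: M] &
    forall x : M, exists (U : set M) (V : set 'rV[R]_d),
      [/\ open U, U x, open V & homeomorphic (set_type U) (set_type V)]].

(* The pair [(t, f)] is the face of tetrahedron [t] opposite to its vertex [f].
   An affine identification of two triangles is determined by a bijection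
   between their vertices; together with [f |-> (mate (t, f)).2] this bijection
   is recorded as a permutation of the four vertex labels. *)
Record gluing (n : nat) := Gluing {
  mate : 'I_n * 'I_4 -> 'I_n * 'I_4;
  gperm : 'I_n * 'I_4 -> 'S_4;
  mateK : involutive mate;
  mate_neq : forall F, mate F != F;
  gperm_opp : forall F, gperm F F.2 = (mate F).2;
  gperm_mate : forall F, gperm (mate F) = ((gperm F)^-1)%g
}.

Section Triangulation.
Variables (n : nat) (T : gluing n).

Section Space.
Variable R : realType.

Notation point := 'rV[R]_4.

(* Barycentric coordinates. *)
Definition simplex : set point :=
  [set x | (forall i, 0 <= x 0 i) /\ \sum_i x 0 i = 1].

(* Sends the vertex [i] to the vertex [s i]. *)
Definition relabel (s : 'S_4) (x : point) : point := \row_i x 0 ((s^-1)%g i).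

Definition tetrahedra : Type := {t : 'I_n & set_type simplex}.

Definition face_identified (x y : tetrahedra) : Prop :=
  exists f : 'I_4,
    [/\ set_val (projT2 x) 0 f = 0,
        projT1 y = (mate T (projT1 x, f)).1 &
        set_val (projT2 y) =
          relabel (gperm T (projT1 x, f)) (set_val (projT2 x))].

Definition underlying_space : topologicalType :=
  quotient_topology {eq_quot (equiv_closure face_identified)}.

Definition triangulates (M : topologicalType) : Prop :=
  homeomorphic underlying_space M.

End Space.

Definition tetra_edge : Type := ('I_n * {P : {set 'I_4} | #|P| == 2})%type.

Definition edge_identified (x y : tetra_edge) : Prop :=
  exists f : 'I_4,
    [/\ f \notin val x.2,
        y.1 = (mate T (x.1, f)).1 &
        val y.2 = gperm T (x.1, f) @: val x.2].

Definition edge : Type := {eq_quot (equiv_closure edge_identified)}.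

Definition edge_class (x : tetra_edge) : edge :=
  \pi_{eq_quot (equiv_closure edge_identified)} x.

Section Colouring.
Variable r : nat.

Definition colours : seq rat := [seq k%:R / 2 | k <- iota 0 r.-1].

Definition colouring : Type := edge -> seq_sub colours.

Definition colour (theta : colouring) (t : 'I_n)
    (P : {P : {set 'I_4} | #|P| == 2}) : rat :=
  ssval (theta (edge_class (t, P))).

(* Every triangle of the triangulation is represented by (two) faces [(t, f)],
   and its bounding edges are the classes of the edges of that face. *)
Definition admissible (theta : colouring) : Prop :=
  forall (t : 'I_n) (f : 'I_4) (P1 P2 P3 : {P : {set 'I_4} | #|P| == 2}),
    uniq [:: P1; P2; P3] ->
    [/\ f \notin val P1, f \notin val P2 & f \notin val P3] ->
    [/\ colour theta t P1 + colour theta t P2 + colour theta t P3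
          \is a Num.int,
        colour theta t P1 <= colour theta t P2 + colour theta t P3 &
        colour theta t P1 + colour theta t P2 + colour theta t P3
          <= (r - 2)%:R].

End Colouring.

Section NormalArcs.
Variable R : realType.

Notation point := 'rV[R]_4.

Definition segment (p q : point) : set point :=
  [set x | exists2 l : R, 0 <= l <= 1 & x = (1 - l) *: p + l *: q].

(* The interior of the edge of the simplex spanned by the vertices in [P]. *)
Definition open_edge (P : {P : {set 'I_4} | #|P| == 2}) : set point :=
  [set x | simplex x /\ forall i, (0 < x 0 i) = (i \in val P)].

(* Arcs are taken with their end points. *)
Definition normal_arc (f : 'I_4) (A : set point) : Prop :=
  exists (P Q : {P : {set 'I_4} | #|P| == 2}) (p q : point),
    [/\ P != Q, f \notin val P & f \notin val Q] /\
    [/\ open_edge P p, open_edge Q q & A = segment p q].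

(* The arcs of a triangle of the triangulation, drawn in the faces of the
   abstract tetrahedra which represent it. *)
Definition arc_family : Type := 'I_n -> 'I_4 -> set (set point).

Definition arc_system (S : arc_family) : Prop :=
  forall (t : 'I_n) (f : 'I_4),
    [/\ finite_set (S t f),
        forall A, S t f A -> normal_arc f A,
        forall A B, S t f A -> S t f B -> A <> B -> A `&` B = set0 &
        let F := mate T (t, f) in
        S F.1 F.2 = [set relabel (gperm T (t, f)) @` A | A in S t f]].

Definition at_most_arcs_per_triangle (k : nat) (S : arc_family) : Prop :=
  forall t f, S t f #<= `I_k.

Definition boundary_arcs (S : arc_family) (t : 'I_n) : set (set point) :=
  \bigcup_f S t f.

(* A cycle is given by the cyclic sequence of the points where consecutive arcs
   meet; that these are distinct within and across cycles makes the cycles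
   simple and pairwise disjoint. *)
Definition forms_cycles (S : arc_family) : Prop :=
  forall t : 'I_n, exists cs : seq (seq point),
    [/\ all (fun c => 2 < size c)%N cs,
        uniq (flatten cs) &
        boundary_arcs S t =
          [set A | exists c p,
             [/\ c \in cs, p \in c & A = segment p (next c p)]]].

(* The colour of an edge is half its number of intersections with arcs.
   Intersections are counted on each edge of a tetrahedron representing it. *)
Definition corresponds (r : nat) (theta : colouring r) (S : arc_family) :
    Prop :=
  forall (t : 'I_n) (P : {P : {set 'I_4} | #|P| == 2}), exists phi : nat,
    2 * colour theta t P = phi%:R /\
    (\bigcup_(A in boundary_arcs S t) A) `&` open_edge P #= `I_phi.

(* The end points [p i s] and [q i s] of the [i]-th arc in the face move
   continuously with the time [s], and the moving arcs form a system closing up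
   into cycles at any time. *)
Definition normally_isotopic (S S' : arc_family) : Prop :=
  exists H : R -> arc_family,
    [/\ H 0 = S, H 1 = S',
        forall s, 0 <= s <= 1 -> arc_system (H s) /\ forms_cycles (H s) &
        forall t f, exists (k : nat) (p q : 'I_k -> R -> point),
          (forall i, {within `[0, 1], continuous (p i)} /\
                     {within `[0, 1], continuous (q i)}) /\
          (forall s, 0 <= s <= 1 ->
             injective (fun i => segment (p i s) (q i s)) /\
             H s t f = range (fun i => segment (p i s) (q i s)))].

Definition cyclic_arc_system (k : nat) (S : arc_family) : Prop :=
  [/\ arc_system S, at_most_arcs_per_triangle k S & forms_cycles S].

End NormalArcs.
End Triangulation.

(* Main.v *)
Require Import Defs.
From HB Require Import structures.
From Stdlib Require Import Relation_Operators.
From mathcomp Require Import fingroup perm.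
From mathcomp Require Import all_boot all_order all_algebra.
From mathcomp Require Import all_classical all_reals all_analysis.
From mathcomp Require Import zify ring lra.

(** A closed system of normal arcs is determined, combinatorially and
    geometrically, by the points where it meets the edges.

    In a triangle abc, an arc cuts off one of the corners, and two disjoint arcs
    at the same corner are nested ([nested_arcs_disjoint], [unnested_arcs_meet]).
    Hence the arcs at the corner a join the i-th point of ab, counted from a, to
    the i-th point of ac, for all i below the number n_a of these arcs, and the
    remaining points of ab belong to the arcs at b.  So |ab| = n_a + n_b, and
    likewise for the other two sides, which means
    n_a = (|ab| + |ac| - |bc|) / 2 ([corner_count]).  Such natural numbers exist
    exactly when |ab| + |ac| + |bc| is even and satisfies the triangle
    inequalities ([balancedP]); the number of arcs in the triangle is then half
    of this sum ([size_face_index]).  With |e| twice the colour of e these are the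
    parity condition, the triangle inequalities and the upper bound constraint
    ([admissible_weights]).

    A [marking] chooses the points on all edges compatibly with the gluings, and
    [arcs_of] draws the arcs.  These arcs close up: a marked point lies on exactly
    one arc of each of the two faces at its edge, so that walking along an arc and
    changing the face at its end are two involutions of the set of arc ends, and
    the orbits of their composite trace the cycles ([cycles_of_involutions],
    [tetra_cycles]).  Conversely, in a system which forms cycles the two faces at
    an edge have the same arc ends on it ([arc_other_face]); this gives a marking
    whose arcs are those of the system ([system_arcs_of]).

    It remains to compare markings and colourings.  A colouring prescribes the
    numbers of points, and evenly spaced points are compatible with every gluing,
    even one which reverses an edge ([colouring_has_arcs]); the numbers of points
    of a marking descend to the edges of the triangulation
    ([marking_colouring]).  Two markings with the same numbers of points are
    joined by linear interpolation, which keeps the points in order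
    ([interpolate_isotopic]).  Along an isotopy, finally, an arc end moves
    continuously and stays on the union of the open edges, so it cannot change its
    edge ([path_open_edge]), and the numbers of points are constant
    ([isotopic_edge_card]). *)

Set Implicit Arguments.
Unset Strict Implicit.
Unset Printing Implicit Defensive.

Import Order.TTheory GRing.Theory Num.Theory.
Import numFieldNormedType.Exports.

(** * Vertex labels of a tetrahedron *)

Section Labels.
Local Open Scope nat_scope.

Implicit Types f a b c : 'I_4.

(** Throughout, [uniq [:: f; a; b; c]] says that a, b, c are the vertices of the
    face opposite to f; stated for all four labels at once, it can be permuted when
    the same edge is seen from another corner or from another face. *)
Lemma uniq4E f a b c : uniq [:: f; a; b; c] =
  [&& f != a, f != b, f != c, a != b, a != c & b != c].
Proof. by rewrite /= !inE !negb_or !andbT -!andbA. Qed.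

Lemma uniq4_mem f a b c i : uniq [:: f; a; b; c] ->
  [\/ i = f, i = a, i = b | i = c].
Proof.
move=> u4; have : i \in [:: f; a; b; c].
  apply: contraT => ni; have /card_uniqP /= E : uniq [:: i; f; a; b; c].
    by rewrite cons_uniq ni.
  by have := max_card [in [:: i; f; a; b; c]]; rewrite E card_ord.
by rewrite !inE => /or4P[] /eqP ->; [constructor 1|constructor 2|constructor 3|constructor 4].
Qed.

Lemma uniq4_acb f a b c : uniq [:: f; a; b; c] -> uniq [:: f; a; c; b].
Proof. by rewrite !uniq4E (eq_sym c b) => /and5P[-> -> -> -> /andP[-> ->]]. Qed.

Lemma uniq4_bac f a b c : uniq [:: f; a; b; c] -> uniq [:: f; b; a; c].
Proof. by rewrite !uniq4E (eq_sym b a) => /and5P[-> -> -> -> /andP[-> ->]]. Qed.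

(** The passage from one face at the edge ab to the other one: the two labels
    off the edge exchange the roles of opposite vertex and third vertex. *)
Lemma uniq4_flip f a b c : uniq [:: f; a; b; c] -> uniq [:: c; a; b; f].
Proof.
rewrite !uniq4E (eq_sym c a) (eq_sym c b) (eq_sym c f) (eq_sym a f) (eq_sym b f).
by move=> /and5P[-> -> -> -> /andP[-> ->]].
Qed.

Lemma uniq4_last f a b c c' : uniq [:: f; a; b; c] -> uniq [:: f; a; b; c'] -> c' = c.
Proof.
move=> u4; have E := uniq4_mem c' u4; rewrite uniq4E => /and5P[_ _ fc _ /andP[ac bc]].
by case: E fc ac bc => ->; rewrite ?eqxx.
Qed.

Lemma uniq4_perm (s : 'S_4) f a b c :
  uniq [:: s f; s a; s b; s c] = uniq [:: f; a; b; c].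
Proof. by rewrite !uniq4E !(inj_eq perm_inj). Qed.

Lemma uniq4_face f a b : f != a -> f != b -> a != b ->
  exists c, uniq [:: f; a; b; c].
Proof.
move=> fa fb ab; have : ~: [set f; a; b] != (finset.set0 : {set 'I_4}).
  rewrite -card_gt0 cardsCs finset.setCK card_ord.
  have : #|[set f; a; b]| <= 3.
    by rewrite (leq_trans (leq_card_setU _ _)) // cards1 addn1 ltnS cards2 ltnS leq_b1.
  lia.
case/set0Pn=> c; rewrite !inE !negb_or -andbA => /and3P[cf ca cb]; exists c.
by rewrite uniq4E fa fb ab (eq_sym f) cf (eq_sym a) ca (eq_sym b) cb.
Qed.

Lemma uniq4_edge a b : a != b -> exists f c, uniq [:: f; a; b; c].
Proof.
move=> ab; have [f [fa fb]] : exists f : 'I_4, f != a /\ f != b.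
  have : ~: [set a; b] != (finset.set0 : {set 'I_4}).
    by rewrite -card_gt0 cardsCs finset.setCK card_ord cards2 ab.
  by case/set0Pn=> f; rewrite !inE negb_or => /andP[]; exists f.
by exists f; exact: uniq4_face.
Qed.

End Labels.

(** * Arcs around the corners of a triangle *)

Section Geometry.
Local Open Scope ring_scope.
Local Open Scope classical_set_scope.
Variable R : realType.
Implicit Types (f a b c : 'I_4) (u v x y w z : R).

(** The parameter is the weight of b, that is, the distance from a on an edge of
    length 1; [edge_point_sym] is the change of orientation of the edge. *)
Definition edge_point a b x : 'rV[R]_4 :=
  (1 - x) *: delta_mx 0 a + x *: delta_mx 0 b.

Lemma edge_pointE a b x i :
  edge_point a b x 0 i = (1 - x) * (i == a)%:R + x * (i == b)%:R.
Proof. by rewrite !mxE eqxx. Qed.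

Lemma edge_point_sym a b x : edge_point b a (1 - x) = edge_point a b x.
Proof. by rewrite /edge_point addrC opprB addrCA subrr addr0. Qed.

Lemma edge_point_inj a b : a != b -> injective (edge_point a b).
Proof.
by move=> /negPf ab x y /(congr1 (fun p : 'rV_4 => p 0 b));
  rewrite !edge_pointE eqxx eq_sym ab /= !mulr0 !add0r !mulr1.
Qed.

Definition corner_arc a b c u v : set 'rV[R]_4 :=
  segment (edge_point a b u) (edge_point a c v).

Lemma segmentC (p q : 'rV[R]_4) : segment p q = segment q p.
Proof.
by apply/seteqP; split=> y [l l01 ->]; exists (1 - l);
  rewrite ?subKr 1?addrC //; lra.
Qed.

Lemma segmentl (p q : 'rV[R]_4) : segment p q p.
Proof. by exists 0; rewrite ?lexx ?ler01 // subr0 scale1r scale0r addr0. Qed.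

Lemma segmentr (p q : 'rV[R]_4) : segment p q q.
Proof. by rewrite segmentC; exact: segmentl. Qed.

(** It suffices to look at a coordinate in which the ends p' and q' differ:
    there, both ends of each segment are convex combinations of the ends of the
    other, which leaves only the parameters 0 and 1. *)
Lemma segment_ends (p q p' q' : 'rV[R]_4) : segment p q = segment p' q' ->
  (p = p' /\ q = q') \/ (p = q' /\ q = p').
Proof.
move=> E.
have [l /andP[l0 l1] pE] : segment p' q' p by rewrite -E; exact: segmentl.
have [m /andP[m0 m1] qE] : segment p' q' q by rewrite -E; exact: segmentr.
have [u /andP[u0 u1] p'E] : segment p q p' by rewrite E; exact: segmentl.
have [v /andP[v0 v1] q'E] : segment p q q' by rewrite E; exact: segmentr.
have [e|/eqP/rowP ne] := eqVneq p' q'.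
  by left; rewrite pE qE -e -!scalerDl !subrK !scale1r.
have [i /eqP nei] : exists i, p' 0 i <> q' 0 i by apply/existsNP.
have Ei (x y z : 'rV[R]_4) k : x = (1 - k) *: y + k *: z ->
    x 0 i = (1 - k) * y 0 i + k * z 0 i by move=> ->; rewrite !mxE.
move: (Ei _ _ _ _ pE) (Ei _ _ _ _ qE) (Ei _ _ _ _ p'E) (Ei _ _ _ _ q'E).
set P := p 0 i; set Q := q 0 i; set P' := p' 0 i; set Q' := q' 0 i.
move=> PE QE P'E Q'E; have d0 : Q' - P' != 0 by rewrite subr_eq0 eq_sym.
have e1 : l * (1 - u) + u * m = 0.
  by apply: (mulIf d0); rewrite mul0r; move: P'E; rewrite PE QE => ?; lra.
have e2 : l * (1 - v) + v * m = 1.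
  by apply: (mulIf d0); rewrite mul1r; move: Q'E; rewrite PE QE => ?; lra.
have [lE|l_neq0] := eqVneq l 0.
  have mE : m = 1 by move: e2; rewrite lE => ?; nra.
  by left; rewrite pE qE lE mE !subr0 !subrr !scale1r !scale0r addr0 add0r.
have uE : u = 1.
  have : 0 <= u * m by exact: mulr_ge0.
  have : 0 <= l * (1 - u) by apply: mulr_ge0 => //; lra.
  move=> ? ?; have /eqP : l * (1 - u) = 0 by lra.
  by rewrite mulf_eq0 (negPf l_neq0) subr_eq0 /= => /eqP.
have mE : m = 0 by move: e1; rewrite uE; lra.
have lE : l = 1 by move: e2; rewrite mE => ?; nra.
by right; rewrite pE qE lE mE !subr0 !subrr !scale1r !scale0r addr0 add0r.
Qed.

Lemma corner_arcC a b c u v : corner_arc a b c u v = corner_arc a c b v u.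
Proof. exact: segmentC. Qed.

Lemma row_ext4 f a b c (p q : 'rV[R]_4) : uniq [:: f; a; b; c] ->
  p 0 f = q 0 f -> p 0 a = q 0 a -> p 0 b = q 0 b -> p 0 c = q 0 c -> p = q.
Proof.
by move=> u4 *; apply/rowP=> i; case: (uniq4_mem i u4) => ->.
Qed.

Lemma corner_arc_coords f a b c u v l (p : 'rV[R]_4) : uniq [:: f; a; b; c] ->
  p = (1 - l) *: edge_point a b u + l *: edge_point a c v <->
  [/\ p 0 f = 0, p 0 a = 1 - (1 - l) * u - l * v,
      p 0 b = (1 - l) * u & p 0 c = l * v].
Proof.
move=> u4; have E i : ((1 - l) *: edge_point a b u + l *: edge_point a c v) 0 i =
   (1 - l) * ((1 - u) * (i == a)%:R + u * (i == b)%:R) +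
   l * ((1 - v) * (i == a)%:R + v * (i == c)%:R).
  by rewrite mxE [X in X + _]mxE [X in _ + X]mxE !edge_pointE.
have [fa fb fc ab [ac bc]] : [/\ f != a, f != b, f != c, a != b & a != c /\ b != c].
  by move: u4; rewrite uniq4E => /and5P[-> -> -> -> /andP[-> ->]].
have [Ef Ea Eb Ec] : let q := (1 - l) *: edge_point a b u + l *: edge_point a c v in
    [/\ q 0 f = 0, q 0 a = 1 - (1 - l) * u - l * v,
        q 0 b = (1 - l) * u & q 0 c = l * v].
  rewrite /= !E !eqxx !(eq_sym b a, eq_sym c a, eq_sym c b).
  rewrite !(negPf fa, negPf fb, negPf fc, negPf ab, negPf ac, negPf bc) /=.
  by split; ring.
by split=> [->|[pf pa pb pc]] //; apply: (row_ext4 u4); rewrite (Ef, Ea, Eb, Ec).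
Qed.

(** Membership in an arc read off in barycentric coordinates; l is the position
    along the arc from ab to ac.  All incidence questions below are reduced to
    real arithmetic by this lemma. *)
Lemma corner_arcP f a b c u v (p : 'rV[R]_4) : uniq [:: f; a; b; c] ->
  corner_arc a b c u v p <-> exists2 l, 0 <= l <= 1 &
    [/\ p 0 f = 0, p 0 a = 1 - (1 - l) * u - l * v,
        p 0 b = (1 - l) * u & p 0 c = l * v].
Proof. by move=> u4; split=> -[l l01] /(corner_arc_coords _ _ _ _ u4) pE; exists l. Qed.

(** In the coordinates x_b and x_c the arc lies on the line
    x_b / u + x_c / v = 1, and the second arc on a line farther from a. *)
Lemma nested_arcs_disjoint f a b c u v u' v' : uniq [:: f; a; b; c] ->
  0 < u -> u < u' -> 0 < v -> v < v' ->
  corner_arc a b c u v `&` corner_arc a b c u' v' = set0.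
Proof.
move=> u4 u0 uu v0 vv; apply/seteqP; split=> // p [].
move=> /(corner_arcP _ _ _ u4)[l /andP[l0 l1] [_ _ pb pc]].
move=> /(corner_arcP _ _ _ u4)[m /andP[m0 m1] [_ _]]; rewrite pb pc => eb ec.
have [ml|lm] := leP l m.
  have : l * v <= m * v by apply: ler_wpM2r => //; exact: ltW.
  have : m * v <= m * v' by apply: ler_wpM2l => //; exact: ltW.
  move=> h1 h2; have m_eq0 : m = 0.
    apply/eqP; apply: contraT => m_neq0.
    have : m * v < m * v' by rewrite ltr_pM2l // lt_def m_neq0.
    lra.
  have l_eq0 : l = 0 by lra.
  by move: eb; rewrite m_eq0 l_eq0; lra.
have : (1 - l) * u <= (1 - l) * u' by apply: ler_wpM2l; lra.
have : (1 - l) * u' < (1 - m) * u' by rewrite ltr_pM2r; lra.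
lra.
Qed.

(** The lines x_b / u + x_c / v = 1 and x_b / u' + x_c / v' = 1 cross, and the
    hypotheses place the crossing on both segments; l and m are the solutions of
    the two linear equations l v = m v' and (1 - l) u = (1 - m) u'. *)
Lemma unnested_arcs_meet f a b c u v u' v' : uniq [:: f; a; b; c] ->
  0 < u -> u <= u' -> 0 < v' -> v' <= v ->
  corner_arc a b c u v `&` corner_arc a b c u' v' !=set0.
Proof.
move=> u4 u0 uu v0 vv.
have [[<- <-]|ne] := pselect (u = u' /\ v = v').
  by exists (edge_point a b u); split; exact: segmentl.
have D0 : 0 < v * u' - u * v'.
  have : u * v' <= u * v by rewrite ler_pM2l.
  have : u * v <= u' * v by rewrite ler_pM2r // (lt_le_trans v0).
  move=> h1 h2; rewrite subr_gt0 lt_neqAle [v * u']mulrC (le_trans h2 h1) andbT.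
  apply/eqP => e; apply: ne.
  have e1 : u * v' = u * v by lra.
  have e2 : u * v = u' * v by lra.
  by split; [apply: (mulIf _ e2); lra|apply/esym; apply: (mulfI _ e1); lra].
set D := _ - _ in D0; have Dn0 : D != 0 by rewrite gt_eqF.
pose l := v' * (u' - u) / D; pose m := v * (u' - u) / D.
have lm : l * v = m * v' by rewrite /l /m; ring.
have lmu : (1 - l) * u = (1 - m) * u'.
  have lD : l * D = v' * (u' - u) by rewrite divfK.
  have mD : m * D = v * (u' - u) by rewrite divfK.
  apply: (mulIf Dn0); rewrite (_ : _ * D = (D - l * D) * u); last by ring.
  rewrite [RHS](_ : _ * D = (D - m * D) * u'); last by ring.
  by rewrite lD mD /D; ring.
have frac x : 0 <= x -> x <= D -> 0 <= x / D <= 1.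
  by move=> x0 xD; rewrite divr_ge0 ?(ltW D0) //= ler_pdivrMr // mul1r.
have l01 : 0 <= l <= 1.
  apply: frac; first by apply: mulr_ge0; lra.
  have : v' * u' <= v * u' by rewrite ler_pM2r; lra.
  rewrite /D; lra.
have m01 : 0 <= m <= 1.
  apply: frac; first by apply: mulr_ge0; lra.
  have : u * v' <= u * v by rewrite ler_pM2l; lra.
  rewrite /D; lra.
pose p := (1 - l) *: edge_point a b u + l *: edge_point a c v; exists p.
split; first by exists l.
have [pf pa pb pc] := (corner_arc_coords u v l p u4).1 erefl.
by apply/(corner_arcP _ _ _ u4); exists m => //; rewrite pf pa pb pc lm lmu.
Qed.

(** At a common point let g < 1 be the coordinate x_c.  Then x_b <= (1 - g) u
    and x_a <= (1 - g) w, so that the coordinates sum up to less than 1 when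
    u + w < 1. *)
Lemma separate_arcs_disjoint f a b c u v w z : uniq [:: f; a; b; c] ->
  0 < u < 1 -> 0 < v < 1 -> 0 < w < 1 -> 0 < z < 1 -> u + w < 1 ->
  corner_arc a b c u v `&` corner_arc b a c w z = set0.
Proof.
move=> u4 u01 v01 w01 z01 uw; apply/seteqP; split=> // p [].
move=> /(corner_arcP _ _ _ u4)[l /andP[l0 l1] [_ pa pb pc]].
move=> /(corner_arcP _ _ _ (uniq4_bac u4))[m /andP[m0 m1] [_]].
rewrite pa pb pc => eb ea ec.
set g := l * v in ec eb ea *; have [gl gm] : g <= l /\ g <= m.
  by split; [|rewrite ec]; apply: ler_piMr => //; lra.
have g1 : g < 1.
  have : g <= 1 * v by apply: ler_wpM2r; lra.
  lra.
have : (1 - l) * u <= (1 - g) * u by apply: ler_wpM2r; lra.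
have : (1 - m) * w <= (1 - g) * w by apply: ler_wpM2r; lra.
have : (1 - g) * (u + w) < 1 - g by rewrite gtr_pMr; lra.
lra.
Qed.

(** When the ends on ab are in the wrong order, the linear equations for a
    common point have a solution with both parameters in the unit interval. *)
Lemma overlapping_arcs_meet f a b c u v w z : uniq [:: f; a; b; c] ->
  0 < u < 1 -> 0 < v < 1 -> 0 < w < 1 -> 0 < z < 1 -> 1 <= u + w ->
  corner_arc a b c u v `&` corner_arc b a c w z !=set0.
Proof.
move=> u4 u01 v01 w01 z01 uw.
pose D := u * z + v * w - v * z.
have Dz : 0 < D - z * (u + w - 1).
  rewrite (_ : _ - _ = z * ((1 - w) * (1 - v)) + v * w * (1 - z)); last first.
    by rewrite /D; ring.
  by rewrite addr_gt0 ?mulr_gt0 //; lra.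
have Dv : 0 < D - v * (u + w - 1).
  rewrite (_ : _ - _ = v * ((1 - u) * (1 - z)) + u * z * (1 - v)); last first.
    by rewrite /D; ring.
  by rewrite addr_gt0 ?mulr_gt0 //; lra.
have zg : 0 <= z * (u + w - 1) by apply: mulr_ge0; lra.
have vg : 0 <= v * (u + w - 1) by apply: mulr_ge0; lra.
have D0 : 0 < D by lra.
have Dn0 : D != 0 by rewrite gt_eqF.
have frac x : 0 <= x -> x <= D -> 0 <= x / D <= 1.
  by move=> x0 xD; rewrite divr_ge0 ?(ltW D0) //= ler_pdivrMr // mul1r.
pose l := z * (u + w - 1) / D; pose m := v * (u + w - 1) / D.
have lm : l * v = m * z by rewrite /l /m; ring.
have lD : l * D = z * (u + w - 1) by rewrite divfK.
have mD : m * D = v * (u + w - 1) by rewrite divfK.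
have sum1 : (1 - l) * u + (1 - m) * w + m * z = 1.
  apply: (mulIf Dn0); rewrite (_ : _ * D = (D - l * D) * u + (D - m * D) * w +
    (m * D) * z); last by ring.
  by rewrite lD mD /D; ring.
pose p := (1 - l) *: edge_point a b u + l *: edge_point a c v; exists p.
split; first by exists l => //; apply: frac; lra.
have [pf pa pb pc] := (corner_arc_coords u v l p u4).1 erefl.
apply/(corner_arcP _ _ _ (uniq4_bac u4)); exists m; first by apply: frac; lra.
by rewrite pf pa pb pc lm; split=> //; lra.
Qed.

End Geometry.

(** * Edges, normal arcs and relabelling *)

Section Edges.
Local Open Scope ring_scope.
Local Open Scope classical_set_scope.
Variable R : realType.
Implicit Types (f a b c : 'I_4) (u v x y w z : R).
Implicit Types P Q : {P : {set 'I_4} | #|P| == 2}.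

Lemma card_default_edge : #|[set (ord0 : 'I_4); ord_max]%SET| == 2.
Proof. by rewrite cards2. Qed.

(** A total function, so that statements about edges need no proof that the
    two vertices differ; for a = b the value is an arbitrary edge. *)
Definition edge_of a b : {P : {set 'I_4} | #|P| == 2} :=
  insubd (exist (fun P : {set 'I_4} => #|P| == 2) _ card_default_edge)
    [set a; b]%SET.

Lemma val_edge_of a b : a != b -> val (edge_of a b) = [set a; b]%SET.
Proof. by move=> ab; rewrite val_insubd cards2 ab. Qed.

Lemma edge_ofC a b : edge_of a b = edge_of b a.
Proof. by rewrite /edge_of (finset.setUC [set a]%SET). Qed.

Lemma edge_ofP P : exists a b, a != b /\ P = edge_of a b.
Proof.
have /cards2P[a [b [ab PE]]] := valP P.
by exists a, b; split=> //; apply: val_inj; rewrite val_edge_of.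
Qed.

Lemma sum4 f a b c (F : 'I_4 -> R) : uniq [:: f; a; b; c] ->
  \sum_i F i = F f + F a + F b + F c.
Proof.
move=> u4; rewrite -big_enum (perm_big [:: f; a; b; c]) /=.
  by rewrite !big_cons big_nil addr0 !addrA.
apply: uniq_perm => //; first exact: enum_uniq.
move=> i; rewrite mem_enum inE; apply/esym.
by case: (uniq4_mem i u4) => ->; rewrite !inE eqxx ?orbT.
Qed.

Lemma edge_point_coords f a b c x : uniq [:: f; a; b; c] ->
  [/\ edge_point a b x 0 f = 0, edge_point a b x 0 a = 1 - x,
      edge_point a b x 0 b = x & edge_point a b x 0 c = 0].
Proof.
rewrite uniq4E => /and5P[/negPf fa /negPf fb /negPf fc /negPf ab /andP[/negPf ac /negPf bc]].
rewrite !edge_pointE !eqxx !(eq_sym b a, eq_sym c a, eq_sym c b) fa fb ab ac bc /=.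
by split; ring.
Qed.

(** An open edge is given by a support condition; on a simplex with vertices
    f, a, b, c the support {a, b} leaves x_b as the only parameter. *)
Lemma open_edgeP a b (p : 'rV[R]_4) : a != b ->
  open_edge (edge_of a b) p <-> exists2 x, 0 < x < 1 & p = edge_point a b x.
Proof.
move=> ab; have [f [c u4]] := uniq4_edge ab.
rewrite /open_edge /simplex /= val_edge_of //.
have [fa fb fc [ac bc]] : [/\ f != a, f != b, f != c & a != c /\ b != c].
  by move: u4; rewrite uniq4E => /and5P[-> -> -> _ /andP[-> ->]].
split=> [[[p0 p1] pE]|[x x01 ->]].
  have pf : p 0 f = 0.
    apply/eqP; rewrite eq_le p0 andbT leNgt pE !inE negb_or fa; exact: fb.
  have pc : p 0 c = 0.
    by apply/eqP; rewrite eq_le p0 andbT leNgt pE !inE negb_or !(eq_sym c) ac.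
  have pa : 0 < p 0 a by rewrite pE !inE eqxx.
  have pb : 0 < p 0 b by rewrite pE !inE eqxx orbT.
  move: p1; rewrite (sum4 _ u4) pf pc => p1.
  have [qf qa qb qc] := edge_point_coords (p 0 b) u4.
  by exists (p 0 b); [lra|apply: (row_ext4 u4); rewrite (qf, qa, qb, qc) //; lra].
have [qf qa qb qc] := edge_point_coords x u4.
split; last first.
  move=> i; rewrite !inE; case: (uniq4_mem i u4) => ->;
    rewrite (qf, qa, qb, qc) ?eqxx ?orbT ?(negPf fa, negPf fb) //=.
  - rewrite -/(is_true _); lra.
  - rewrite -/(is_true _); lra.
  - by rewrite ltxx !(eq_sym c) (negPf ac) (negPf bc).
split; last by rewrite (sum4 _ u4) qf qa qb qc; lra.
by move=> i; case: (uniq4_mem i u4) => ->; rewrite (qf, qa, qb, qc) //; lra.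
Qed.

Lemma in_edge_of i a b : a != b -> (i \in val (edge_of a b)) = (i == a) || (i == b).
Proof. by move=> ab; rewrite val_edge_of // !inE. Qed.

(** The support of an interior point of an edge is the edge, and the parameter
    is determined up to the orientation. *)
Lemma edge_point_eq a b a' b' x y : a != b -> a' != b' -> 0 < x < 1 -> 0 < y < 1 ->
  edge_point a b x = edge_point a' b' y ->
  [/\ a' = a, b' = b & y = x] \/ [/\ a' = b, b' = a & y = 1 - x].
Proof.
move=> ab ab' x01 y01 E.
have /(open_edgeP _ ab)[_ Ex] :
    exists2 z, 0 < z < 1 & edge_point a b x = edge_point a b z by exists x.
have /(open_edgeP _ ab')[_ Ey] :
    exists2 z, 0 < z < 1 & edge_point a b x = edge_point a' b' z by exists y.
have a'ab : (a' == a) || (a' == b) by rewrite -in_edge_of // -Ex Ey in_edge_of ?eqxx.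
have b'ab : (b' == a) || (b' == b) by rewrite -in_edge_of // -Ex Ey in_edge_of ?eqxx ?orbT.
case/orP: a'ab ab' E => /eqP->; case/orP: b'ab => /eqP->; rewrite ?eqxx // => _.
  by move/(edge_point_inj ab)=> <-; left.
rewrite -[edge_point b a y]edge_point_sym => /(edge_point_inj ab)->; right.
by split=> //; rewrite subKr.
Qed.

(** Two distinct edges of a triangle share exactly one vertex a, so an arc is
    described by this corner and the distances of its ends from it. *)
Lemma normal_arcP f (A : set 'rV[R]_4) : normal_arc f A <->
  exists a b c u v,
    [/\ uniq [:: f; a; b; c], 0 < u < 1, 0 < v < 1 & A = corner_arc a b c u v].
Proof.
split.
  move=> [P [Q [p [q [[PQ fP fQ] [Pp Qq ->]]]]]].
  have [a [b [ab PE]]] := edge_ofP P; have [a' [b' [ab' QE]]] := edge_ofP Q.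
  move: PQ fP fQ Pp Qq; rewrite {}PE {}QE !in_edge_of // !negb_or.
  move=> PQ /andP[fa fb] /andP[fa' fb'].
  move=> /(open_edgeP _ ab)[u u01 ->] /(open_edgeP _ ab')[v v01 ->].
  have [c u4] := uniq4_face fa fb ab.
  have flip x : 0 < x < 1 -> 0 < 1 - x < 1 by lra.
  case: (uniq4_mem a' u4) ab' PQ fa' => ->; first (by rewrite eqxx);
  case: (uniq4_mem b' u4) fb' => ->; rewrite ?eqxx // 1?edge_ofC ?eqxx // => _ _ _ _.
  - by exists a, b, c, u, v; split.
  - exists b, a, c, (1 - u), v; split=> //; [exact: uniq4_bac|exact: flip|].
    by rewrite /corner_arc edge_point_sym.
  - exists a, b, c, u, (1 - v); split=> //; first exact: flip.
    by rewrite /corner_arc edge_point_sym.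
  - exists b, a, c, (1 - u), (1 - v); split; rewrite ?flip //; first exact: uniq4_bac.
    by rewrite /corner_arc !edge_point_sym.
move=> [a [b [c [u [v [u4 u01 v01 ->]]]]]].
have : [&& f != a, f != b, f != c, a != b, a != c & b != c] by rewrite -uniq4E.
move=> /and5P[fa fb fc ab /andP[ac bc]].
exists (edge_of a b), (edge_of a c), (edge_point a b u), (edge_point a c v).
rewrite !in_edge_of // !negb_or fa fb fc; split; split=> //.
- apply/eqP=> /(congr1 val); rewrite !val_edge_of // => /setP/(_ b).
  by rewrite !inE eqxx orbT (eq_sym b a) (negPf ab) (negPf bc).
- by apply/open_edgeP => //; exists u.
- by apply/open_edgeP => //; exists v.
Qed.

(** An inner point of the arc has three positive coordinates, and hence lies on
    no edge. *)
Lemma corner_arc_open_edge f a b c u v P (p : 'rV[R]_4) : uniq [:: f; a; b; c] ->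
  0 < u < 1 -> 0 < v < 1 -> corner_arc a b c u v p -> open_edge P p ->
  p = edge_point a b u \/ p = edge_point a c v.
Proof.
move=> u4 u01 v01 [l l01 pE]; have [pf pa pb pc] := (corner_arc_coords u v l p u4).1 pE.
have [l0|l0] := eqVneq l 0.
  by left; rewrite pE l0 subr0 scale1r scale0r addr0.
have [l1|l1] := eqVneq l 1.
  by right; rewrite pE l1 subrr scale1r scale0r add0r.
have {l0 l1} l01 : 0 < l < 1 by rewrite !lt_neqAle eq_sym l0 l1.
have [x [y [xy ->]]] := edge_ofP P; case=> _ pos.
have pos_a : 0 < p 0 a.
  rewrite pa (_ : _ - _ = (1 - l) * (1 - u) + l * (1 - v)); last by ring.
  by rewrite addr_gt0 ?mulr_gt0 //; lra.
have pos_b : 0 < p 0 b by rewrite pb mulr_gt0 //; lra.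
have pos_c : 0 < p 0 c by rewrite pc mulr_gt0 //; lra.
move: pos_a pos_b pos_c u4; rewrite !pos !in_edge_of // uniq4E.
by move=> /orP[]/eqP-> /orP[]/eqP-> /orP[]/eqP->; rewrite !eqxx !(andbF, andFb).
Qed.

(** The coordinate of the vertex opposite to the face vanishes on the arc, and
    is positive at points of the edges through this vertex. *)
Lemma normal_arc_edge f (A : set 'rV[R]_4) a b x : a != b -> 0 < x < 1 ->
  normal_arc f A -> A (edge_point a b x) -> f != a /\ f != b.
Proof.
move=> ab x01 /normal_arcP[a' [b' [c' [u [v [u4' _ _ ->]]]]]].
move=> /(corner_arcP _ _ _ u4')[l _ [pf _ _ _]].
split; apply/eqP=> E; move: pf; rewrite edge_pointE E eqxx.
  by rewrite (negPf ab) /=; lra.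
by rewrite (eq_sym b) (negPf ab) /=; lra.
Qed.

Lemma corner_arc_edge f a b c u v x : uniq [:: f; a; b; c] ->
  0 < u < 1 -> 0 < v < 1 -> 0 < x < 1 ->
  corner_arc a b c u v (edge_point a b x) <-> x = u.
Proof.
move=> u4 u01 v01 x01; split=> [|->]; last exact: segmentl.
have [qf qa qb qc] := edge_point_coords x u4.
move/(corner_arcP _ _ _ u4)=> [l l01 []]; rewrite qb qc => _ _ xE /esym/eqP.
by rewrite mulf_eq0 [v == 0]gt_eqF ?orbF; [|lra] => /eqP l0; move: xE; rewrite l0; lra.
Qed.

Lemma corner_arc_opposite f a b c u v x : uniq [:: f; a; b; c] ->
  0 < u < 1 -> 0 < v < 1 -> ~ corner_arc a b c u v (edge_point b c x).
Proof.
move=> u4 u01 v01 /(corner_arcP _ _ _ u4)[l l01 [_]].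
have u4' : uniq [:: a; b; c; f] by rewrite -(rot_uniq 3).
have [-> _ _ _] := edge_point_coords x u4'.
move=> + _ _.
have : (1 - l) * u <= (1 - l) * Num.max u v by apply: ler_wpM2l; rewrite ?le_max ?lexx//; lra.
have : l * v <= l * Num.max u v by apply: ler_wpM2l; rewrite ?le_max ?lexx ?orbT //; lra.
have : Num.max u v < 1 by rewrite gt_max; lra.
lra.
Qed.

Lemma relabel_delta (s : 'S_4) a : relabel s (delta_mx 0 a : 'rV[R]_4) = delta_mx 0 (s a).
Proof.
by apply/rowP=> i; rewrite !mxE eqxx /= -(inj_eq (@perm_inj _ s)) permKV.
Qed.

Lemma relabel_comb (s : 'S_4) k m (p q : 'rV[R]_4) :
  relabel s (k *: p + m *: q) = k *: relabel s p + m *: relabel s q.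
Proof. by apply/rowP=> i; rewrite !mxE. Qed.

Lemma relabel_edge_point (s : 'S_4) a b x :
  relabel s (edge_point a b x) = edge_point (s a) (s b) x.
Proof. by rewrite relabel_comb !relabel_delta. Qed.

Lemma relabel_corner_arc (s : 'S_4) a b c u v :
  relabel s @` corner_arc a b c u v = corner_arc (s a) (s b) (s c) u v.
Proof.
apply/seteqP; split=> p; rewrite /corner_arc -!(relabel_edge_point s).
  by move=> [q [l l01 ->] <-]; exists l; rewrite // relabel_comb.
by move=> [l l01 ->]; rewrite -relabel_comb; apply: imageP; exists l.
Qed.

End Edges.

(** * Cycles from two involutions *)

Section TwoInvolutions.
Local Open Scope nat_scope.
Variables (D : finType) (V : eqType) (rho tau : D -> D) (h : D -> V).
Hypothesis rhoK : involutive rho.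
Hypothesis tauK : involutive tau.
Hypothesis rho_neq : forall d, rho d != d.
Hypothesis tau_neq : forall d, tau d != d.
Hypothesis h_tau : forall d, h (tau d) = h d.
Hypothesis h_eq : forall d d', h d = h d' -> d' = d \/ d' = tau d.

Let sigma d := tau (rho d).

Hypothesis sigma_neq : forall d, sigma d != d.
Hypothesis sigma2_neq : forall d, sigma (sigma d) != d.

Let sigma_inj : injective sigma.
Proof. by apply: inj_comp; apply: can_inj; [exact: tauK|exact: rhoK]. Qed.

(** Since rho and tau are involutions, tau conjugates sigma to its inverse.
    So an equality sigma^k d = tau d gives sigma^(k-2) e = tau e for e = sigma d,
    and descending by steps of 2 ends in a fixed point of tau or of rho. *)
Lemma iter_sigma_neq_tau k d : iter k sigma d != tau d.
Proof.
have [m km] := ubnP k; elim: m k km d => // m IH [|[|k]] km d.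
- by rewrite eq_sym tau_neq.
- by rewrite /= (can_eq tauK) rho_neq.
rewrite iterS iterSr (can_eq tauK); apply/eqP=> E.
have /eqP[] := IH k (ltnW km) (sigma d).
by rewrite -[LHS]rhoK E /sigma tauK.
Qed.

Let fc := fconnect sigma.

Lemma fconnect_tauF d : fc d (tau d) = false.
Proof.
by apply/negP=> /iter_findex E; have /eqP[] := iter_sigma_neq_tau (findex sigma d (tau d)) d.
Qed.

(** tau reverses the orbits of sigma, as tau sigma tau is the inverse of
    sigma. *)
Lemma fconnect_tau d e : fc d e -> fc (tau d) (tau e).
Proof.
move=> de; have /iter_findex <- : fc e d by rewrite /fc (fconnect_sym sigma_inj).
elim: (findex _ _ _) => [|k IH]; first exact: connect0.
rewrite iterS; apply: connect_trans IH; set y := iter _ _ _.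
have <- : sigma (tau (sigma y)) = tau y by rewrite /sigma tauK rhoK.
exact: fconnect1.
Qed.

Let chosen d := enum_rank (froot sigma d) < enum_rank (froot sigma (tau d)).

(** tau pairs each orbit of sigma with a different one, which runs through the
    same values of h in the opposite direction.  [chosen] selects one orbit of each
    pair by comparing the ranks of representatives, and so does not depend on the
    element of the orbit. *)
Lemma chosen_fconnect d e : fc d e -> chosen d = chosen e.
Proof.
move=> de; have rt x y : fc x y -> froot sigma x = froot sigma y.
  by move=> xy; apply/eqP; rewrite (root_connect (fconnect_sym sigma_inj)).
by rewrite /chosen (rt _ _ de) (rt _ _ (fconnect_tau de)).
Qed.

Lemma chosen_tau d : chosen (tau d) = ~~ chosen d.
Proof.
rewrite /chosen tauK -leqNgt [RHS]leq_eqVlt.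
rewrite -[X in X || _]/(enum_rank _ == enum_rank _ :> nat).
have -> // : enum_rank (froot sigma (tau d)) == enum_rank (froot sigma d) :> nat = false.
apply/negP=> /eqP/val_inj/enum_rank_inj/eqP.
by rewrite (root_connect (fconnect_sym sigma_inj)) (fconnect_sym sigma_inj) -/fc fconnect_tauF.
Qed.

Let cyc d := [seq h x | x <- orbit sigma d].
Let reps := [seq d <- enum D | (froot sigma d == d) && chosen d].

Lemma h_orbit_inj d : {in orbit sigma d &, injective h}.
Proof.
move=> x y; rewrite -!fconnect_orbit => dx dy /h_eq[//|yE].
have : fc x y by apply: connect_trans dy; rewrite (fconnect_sym sigma_inj).
by rewrite yE fconnect_tauF.
Qed.

Lemma next_cyc d x : x \in orbit sigma d -> next (cyc d) (h x) = h (rho x).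
Proof.
move=> xd; pose e v w := [exists y in orbit sigma d, (v == h y) && (w == h (sigma y))].
have /next_cycle/(_ (map_f h xd)) : cycle e (cyc d).
  rewrite cycle_map; apply: (sub_in_cycle (P := mem (orbit sigma d))) (cycle_orbit sigma_inj d).
    move=> y z yd _ /eqP <-; apply/exists_inP; exists y => //=; by rewrite !eqxx.
  by apply/allP.
case/exists_inP=> y yd /andP[/eqP/(h_orbit_inj xd yd) -> /eqP ->].
by rewrite h_tau.
Qed.

(** Think of D as the set of arc ends, where h d is the position of the end d,
    rho passes to the other end of the same arc, and tau to the other arc end at
    the same position.  The chosen orbits of sigma, mapped by h, are the cycles: an
    orbit does not pass twice through the same point, since it contains no d
    together with tau d, and orbits of different pairs have no point in common.
    An arc is found in the cycle of one of its ends, according to which of the two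
    directions is chosen. *)
Lemma cycles_of_involutions : exists cs : seq (seq V),
  [/\ all (fun c => 2 < size c) cs, uniq (flatten cs),
      forall c p, c \in cs -> p \in c ->
        exists d, p = h d /\ next c p = h (rho d) &
      forall d, exists c p, [/\ c \in cs, p \in c &
        (p = h d /\ next c p = h (rho d)) \/
        (p = h (rho d) /\ next c p = h d)]].
Proof.
have csym := fconnect_sym sigma_inj.
exists [seq cyc d | d <- reps]; split.
- apply/allP=> c /mapP[d _ ->]; rewrite size_map size_orbit ltnNge; apply/negP.
  have := iter_order sigma_inj d; have := order_gt0 sigma d.
  case: (order sigma d) => [|[|[|//]]] // _ /= E _.
    by have /eqP[] := sigma_neq d.
  by have /eqP[] := sigma2_neq d.
- apply: (@allpairs_uniq_dep _ (fun=> D) _ (fun=> h) reps (orbit sigma)).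
  + exact/filter_uniq/enum_uniq.
  + by move=> d _; exact: orbit_uniq.
  move=> _ _ /allpairsPdep[d [x [dr xd ->]]] /allpairsPdep[d' [x' [dr' xd' ->]]] /=.
  move: dr dr'; rewrite !mem_filter => /andP[/andP[/eqP dE dc] _] /andP[/andP[/eqP dE' dc'] _].
  move: xd xd'; rewrite -!fconnect_orbit => xd xd' /h_eq[xE|xE].
    rewrite xE in xd' *; suff -> : d = d' by [].
    rewrite -dE -dE'; apply/eqP; rewrite root_connect //; apply: connect_trans xd _.
    by rewrite csym.
  exfalso; have := chosen_fconnect xd'; rewrite xE chosen_tau -(chosen_fconnect xd) dc dc'.
  by [].
- move=> c p /mapP[d _ ->] /mapP[x xd ->]; exists x; split=> //; exact: next_cyc.
have cov d : chosen d -> exists c p, [/\ c \in [seq cyc d | d <- reps], p \in c &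
     p = h d /\ next c p = h (rho d)].
  move=> dc; have rd : fc (froot sigma d) d by rewrite /fc csym connect_root.
  exists (cyc (froot sigma d)), (h d); split.
  + apply: map_f; rewrite mem_filter mem_enum andbT (chosen_fconnect rd) dc andbT.
    by rewrite root_root.
  + by apply: map_f; rewrite -fconnect_orbit.
  + by split=> //; apply: next_cyc; rewrite -fconnect_orbit.
move=> d; have [/cov[c [p [? ? ?]]]|nd] := boolP (chosen d).
  by exists c, p; split=> //; left.
have /cov[c [p [cc pc]]] : chosen (rho d).
  rewrite (chosen_fconnect (fconnect1 sigma (rho d))) /sigma rhoK chosen_tau //.
by rewrite rhoK => E; exists c, p; split=> //; right.
Qed.

End TwoInvolutions.

(** * The number of arcs at each corner *)

Section Counts.
Local Open Scope nat_scope.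
Implicit Types (f a b c : 'I_4) (phi : 'I_4 -> 'I_4 -> nat).

(** The solution n_a of the equations |ab| = n_a + n_b, |ac| = n_a + n_c,
    |bc| = n_b + n_c.  Truncated subtraction and halving are harmless for balanced
    numbers. *)
Definition corner_count phi a b c := (phi a b + phi a c - phi b c)./2.

(** The second condition says that the solution in [corner_count] is an
    exact solution in natural numbers. *)
Definition balanced phi :=
  (forall a b, a != b -> phi b a = phi a b) /\
  (forall f a b c, uniq [:: f; a; b; c] ->
     phi a b = corner_count phi a b c + corner_count phi b a c).

Lemma corner_countC phi f a b c : balanced phi -> uniq [:: f; a; b; c] ->
  corner_count phi a c b = corner_count phi a b c.
Proof.
move=> [sym _]; rewrite uniq4E => /and5P[_ _ _ _ /andP[_ bc]].
by rewrite /corner_count (sym _ _ bc) addnC.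
Qed.

Lemma corner_count_le phi f a b c : balanced phi -> uniq [:: f; a; b; c] ->
  corner_count phi a b c <= phi a b /\ corner_count phi a b c <= phi a c.
Proof.
move=> B u4; have [_ E] := B; split; first by rewrite (E _ _ _ _ u4) leq_addr.
by rewrite -(corner_countC B u4) (E _ _ _ _ (uniq4_acb u4)) leq_addr.
Qed.

(** One triple for each corner of the face, with the other two vertices in an
    arbitrary order, in order that each arc is listed once in [face_index]. *)
Definition corners f : seq ('I_4 * 'I_4 * 'I_4) :=
  let a := lift f ord0 in let b := lift f (inord 1) in let c := lift f ord_max in
  [:: (a, b, c); (b, a, c); (c, a, b)].

Lemma corners_uniq4 f : uniq [:: f; lift f ord0; lift f (inord 1); lift f ord_max].
Proof.
rewrite uniq4E !neq_lift !(inj_eq lift_inj) /=.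
by rewrite -!(inj_eq val_inj) /= inordK.
Qed.

Lemma mem_corners f a b c : (a, b, c) \in corners f -> uniq [:: f; a; b; c].
Proof.
have u4 := corners_uniq4 f.
rewrite /corners !inE => /or3P[] /eqP[-> -> ->] //; first exact: uniq4_bac.
exact/uniq4_bac/uniq4_acb.
Qed.

Lemma corners_of f a b c : uniq [:: f; a; b; c] ->
  (a, b, c) \in corners f \/ (a, c, b) \in corners f.
Proof.
have u4 := corners_uniq4 f; rewrite /corners !inE !xpair_eqE.
move: u4; set x := lift f _; set y := lift f _; set z := lift f _ => u4.
rewrite uniq4E => /and5P[fa fb fc ab /andP[ac bc]].
case: (uniq4_mem a u4) fa fb fc ab ac bc => ->; first (by rewrite eqxx);
case: (uniq4_mem b u4) => ->; rewrite ?eqxx //;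
case: (uniq4_mem c u4) => ->; rewrite ?eqxx ?orbT //; by [left|right].
Qed.

Lemma corners_fst_inj f a b c b' c' : (a, b, c) \in corners f ->
  (a, b', c') \in corners f -> (b, c) = (b', c').
Proof.
have := corners_uniq4 f; rewrite uniq4E /corners !inE !xpair_eqE.
set x := lift f _; set y := lift f _; set z := lift f _.
move=> /and5P[_ _ _ xy /andP[xz yz]].
by case/or3P=> /andP[/andP[/eqP-> /eqP->] /eqP->];
  rewrite !eqxx ?(eq_sym y x, eq_sym z x, eq_sym z y)
    ?(negPf xy, negPf xz, negPf yz) /= ?orbF => /andP[/eqP-> /eqP->].
Qed.

Lemma corners_all_uniq f : uniq (corners f).
Proof.
have := corners_uniq4 f; rewrite uniq4E => /and5P[_ _ _ xy /andP[xz yz]].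
by rewrite /= !inE !xpair_eqE !(negPf xy, negPf xz, negPf yz).
Qed.

(** A fixed list indexing the arcs of a face, which depends on the numbers of
    points only: along an isotopy the same list enumerates the arcs at all
    times. *)
Definition face_index phi f : seq ('I_4 * 'I_4 * 'I_4 * nat) :=
  [seq (x, i) | x <- corners f, i <- iota 0 (corner_count phi x.1.1 x.1.2 x.2)].

Lemma mem_face_index phi f a b c i : ((a, b, c), i) \in face_index phi f =
  ((a, b, c) \in corners f) && (i < corner_count phi a b c).
Proof.
apply/allpairsPdep/andP => [[x [j [xf]]]|[cf ic]].
  by rewrite mem_iota add0n /= => jx [E ->]; rewrite -E in xf jx *.
by exists (a, b, c), i; split; rewrite ?mem_iota.
Qed.

Lemma face_index_uniq phi f : uniq (face_index phi f).
Proof.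
apply: allpairs_uniq_dep; first exact: corners_all_uniq.
  by move=> *; exact: iota_uniq.
by move=> [? ?] [? ?] /= _ _ [-> ->].
Qed.

(** Each arc of a triangle has two ends on its sides. *)
Lemma size_face_index phi f a b c : balanced phi -> uniq [:: f; a; b; c] ->
  (size (face_index phi f)).*2 = phi a b + phi a c + phi b c.
Proof.
move=> B u4; have [sym E] := B; have v4 := corners_uniq4 f.
have -> : phi a b + phi a c + phi b c =
    let x := lift f ord0 in let y := lift f (inord 1) in let z := lift f ord_max in
    phi x y + phi x z + phi y z.
  move: v4 => /=; set x := lift f _; set y := lift f _; set z := lift f _ => v4.
  have S : forall a b, phi a b = phi b a.
    by move=> d e; have [->|/sym] := eqVneq d e.
  move: u4; rewrite uniq4E => /and5P[fa fb fc ab /andP[ac bc]].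
  case: (uniq4_mem a v4) fa fb fc ab ac bc => ->; first (by rewrite eqxx);
  case: (uniq4_mem b v4) => ->; rewrite ?eqxx //;
  case: (uniq4_mem c v4) => ->; rewrite ?eqxx //= => *;
  rewrite !(S y x, S z x, S z y); lia.
rewrite /face_index size_allpairs_dep /corners /= !size_iota.
rewrite (E _ _ _ _ v4) (E _ _ _ _ (uniq4_acb v4)).
rewrite (E _ _ _ _ (uniq4_acb (uniq4_bac v4))).
rewrite -!(corner_countC B (uniq4_acb v4)) -!(corner_countC B (uniq4_acb (uniq4_bac v4))).
rewrite -!(corner_countC B (uniq4_acb (uniq4_bac (uniq4_acb v4)))); lia.
Qed.

(** In a list of size s, the entry of index i has index s - (i + 1) after
    reversal.  The four facts on this index are used for the two orientations
    of an edge. *)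
Lemma rev_indexK s i : i < s -> s - (s - i.+1).+1 = i.
Proof. lia. Qed.

Lemma rev_index_lt s i : i < s -> s - i.+1 < s.
Proof. lia. Qed.

Lemma rev_index_ltD s m n i : s = m + n -> m <= i -> i < s -> s - i.+1 < n.
Proof. lia. Qed.

Lemma rev_index_gtD s m n i j : s = m + n -> i < m -> j < n -> i < s - j.+1.
Proof. lia. Qed.

End Counts.

(** * The arcs drawn from marked points on the edges *)

Section TetraMarking.
Local Open Scope ring_scope.
Local Open Scope classical_set_scope.
Variable R : realType.
Implicit Types (f a b c : 'I_4) (i j : nat) (u v x y w z : R).

Lemma card_seq (T : choiceType) (s : seq T) : uniq s -> ([set` s] #= `I_(size s))%card.
Proof.
move=> us; case: s us => [|x0 s] us.
  by rewrite set_nil /= II0 card_eq0.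
rewrite card_eq_sym; set s' := x0 :: s.
have -> : [set` s'] = nth x0 s' @` `I_(size s').
  apply/seteqP; split=> y /=; first by move=> /(nthP x0)[i ? <-]; exists i.
  by move=> [i ? <-]; exact: mem_nth.
rewrite card_eq_sym; apply: inj_card_eq => i j; rewrite !inE /= => ? ? /eqP.
by rewrite nth_uniq // => /eqP.
Qed.

Definition weights (p : 'I_4 -> 'I_4 -> seq R) a b : nat := size (p a b).

(** The list for the pair a, b consists of the distances from a of the marked
    points on the edge ab, in increasing order; an edge is thus described twice,
    once for each orientation. *)
Record tetra_marking (p : 'I_4 -> 'I_4 -> seq R) : Prop := TetraMarking {
  mark_bounds : forall a b x, a != b -> x \in p a b -> 0 < x < 1;
  mark_sorted : forall a b, a != b -> sorted <%R (p a b);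
  mark_rev : forall a b, a != b -> p b a = rev [seq 1 - x | x <- p a b];
  mark_balanced : balanced (weights p)
}.

Definition mark_arc (p : 'I_4 -> 'I_4 -> seq R) (y : 'I_4 * 'I_4 * 'I_4 * nat) :
    set 'rV[R]_4 :=
  corner_arc y.1.1.1 y.1.1.2 y.1.2 (p y.1.1.1 y.1.1.2)`_y.2 (p y.1.1.1 y.1.2)`_y.2.

Definition face_arcs (p : 'I_4 -> 'I_4 -> seq R) f : set (set 'rV[R]_4) :=
  [set A | exists a b c i, [/\ uniq [:: f; a; b; c],
     (i < corner_count (weights p) a b c)%N & A = mark_arc p (a, b, c, i)]].

Variable p : 'I_4 -> 'I_4 -> seq R.
Hypothesis pM : tetra_marking p.

Let cnt := corner_count (weights p).
Let B := mark_balanced pM.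

Lemma mark_nth_bounds a b i : a != b -> (i < size (p a b))%N -> 0 < (p a b)`_i < 1.
Proof. by move=> ab ip; apply: (mark_bounds pM ab); exact: mem_nth. Qed.

Lemma mark_nth_lt a b i j : a != b -> (j < size (p a b))%N -> (i < j)%N ->
  (p a b)`_i < (p a b)`_j.
Proof.
move=> ab jp ij; have := mark_sorted pM ab; rewrite lt_sorted_pairwise.
by move=> /(pairwiseP 0)/(_ i j); apply; rewrite ?inE // (ltn_trans ij).
Qed.

Lemma mark_nth_inj a b i j : a != b -> (i < size (p a b))%N ->
  (j < size (p a b))%N -> (p a b)`_i = (p a b)`_j -> i = j.
Proof.
move=> ab ip jp E; case: (ltngtP i j) => // [/(mark_nth_lt ab jp)|/(mark_nth_lt ab ip)];
  by rewrite E ltxx.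
Qed.

Lemma mark_size_sym a b : a != b -> size (p b a) = size (p a b).
Proof. by move=> ab; rewrite (mark_rev pM ab) size_rev size_map. Qed.

Lemma mark_nth_rev a b i : a != b -> (i < size (p a b))%N ->
  (p b a)`_i = 1 - (p a b)`_(size (p a b) - i.+1).
Proof.
move=> ab ip; rewrite (mark_rev pM ab) nth_rev ?size_map // (nth_map 0) //.
exact: rev_index_lt.
Qed.

Lemma mem_mark_rev a b x : a != b -> (x \in p a b) = (1 - x \in p b a).
Proof.
move=> ab; rewrite (mark_rev pM ab) mem_rev (mem_map (f := fun x => 1 - x)) //.
by move=> y z /(congr1 (fun t => 1 - t)); rewrite !subKr.
Qed.

Lemma mark_sizeE f a b c : uniq [:: f; a; b; c] ->
  size (p a b) = (cnt a b c + cnt b a c)%N.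
Proof. exact: B.2. Qed.

Lemma mark_corner f a b c i : uniq [:: f; a; b; c] -> (i < cnt a b c)%N ->
  (i < size (p a b))%N /\ (i < size (p a c))%N.
Proof. by move=> /(corner_count_le B)[h1 h2] ic; split; exact: leq_trans ic _. Qed.

Lemma mark_corner_bounds f a b c i : uniq [:: f; a; b; c] -> (i < cnt a b c)%N ->
  0 < (p a b)`_i < 1 /\ 0 < (p a c)`_i < 1.
Proof.
move=> u4 /(mark_corner u4)[h1 h2].
have : [&& f != a, f != b, f != c, a != b, a != c & b != c] by rewrite -uniq4E.
by move=> /and5P[_ _ _ ab /andP[ac _]]; split; exact: mark_nth_bounds.
Qed.

Lemma mark_arcC a b c i : mark_arc p (a, b, c, i) = mark_arc p (a, c, b, i).
Proof. exact: corner_arcC. Qed.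

Lemma face_arcs_normal f A : face_arcs p f A -> normal_arc f A.
Proof.
move=> [a [b [c [i [u4 ic ->]]]]]; apply/normal_arcP.
have [h1 h2] := mark_corner_bounds u4 ic.
by exists a, b, c, (p a b)`_i, (p a c)`_i.
Qed.

(** At the same corner the arcs are nested because the marked points are in
    increasing order.  At different corners a and b they are separated on ab: the
    arcs at a use the first points of ab and those at b use the last ones, and
    there are enough points for both by the balance condition. *)
Lemma mark_arc_disj f a b c i a' b' c' j :
  uniq [:: f; a; b; c] -> (i < cnt a b c)%N ->
  uniq [:: f; a'; b'; c'] -> (j < cnt a' b' c')%N -> (a, i) <> (a', j) ->
  mark_arc p (a, b, c, i) `&` mark_arc p (a', b', c', j) = set0.
Proof.
move=> u4 ic u4' jc ne.
(* An arc may be read from either of its two ends, which exchanges b and c;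
   H1 to H4 are the four readings of the two arcs. *)
wlog : b c b' c' u4 ic u4' jc / [/\ a' = a, b' = b & c' = c] \/
    [/\ a' = b, b' = a & c' = c].
  have := u4; rewrite uniq4E => /and5P[fa fb fc ab /andP[ac bc]] H.
  have Cb := corner_countC B; have ic' : (i < cnt a c b)%N by rewrite /cnt (Cb _ _ _ _ u4).
  have jc' : (j < cnt a' c' b')%N by rewrite /cnt (Cb _ _ _ _ u4').
  have H1 := H _ _ _ _ u4 ic u4' jc.
  have H2 := H _ _ _ _ (uniq4_acb u4) ic' u4' jc.
  have H3 := H _ _ _ _ u4 ic (uniq4_acb u4') jc'.
  have H4 := H _ _ _ _ (uniq4_acb u4) ic' (uniq4_acb u4') jc'.
  move: H2 H3 H4; rewrite ![mark_arc p (_, c, b, _)]mark_arcC.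
  rewrite ![mark_arc p (_, c', b', _)]mark_arcC.
  move: H1 (u4'); rewrite uniq4E.
  case: (uniq4_mem a' u4) => ->; rewrite ?eqxx //;
  case: (uniq4_mem b' u4) => ->; rewrite ?eqxx ?andbF //;
  case: (uniq4_mem c' u4) => ->; rewrite ?eqxx ?andbF //= => H1 _ H2 H3 H4;
   first [by apply: H1; left | by apply: H1; right | by apply: H2; right
         | by apply: H3; left | by apply: H3; right | by apply: H4; right].
have := u4; rewrite uniq4E => /and5P[fa fb fc ab /andP[ac bc]].
have [ib ic0] := mark_corner u4 ic.
have [bi1 bi2] := mark_corner_bounds u4 ic.
have [bj1 bj2] := mark_corner_bounds u4' jc.
have [jb jc0] := mark_corner u4' jc.
case=> -[? ? ?]; subst a' b' c'.
  case: (ltngtP i j) => [ij|ji|ij]; last by rewrite ij in ne.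
    apply: (nested_arcs_disjoint u4); rewrite /= ?mark_nth_lt //; lra.
  rewrite setIC; apply: (nested_arcs_disjoint u4); rewrite /= ?mark_nth_lt //; lra.
apply: (separate_arcs_disjoint u4) => //=; rewrite (mark_nth_rev ab) -?(mark_size_sym ab) //.
rewrite mark_size_sym // addrCA gtrDl subr_lt0; apply: mark_nth_lt => //.
  by apply: rev_index_lt; rewrite -mark_size_sym.
exact: rev_index_gtD (mark_sizeE u4) ic jc.
Qed.

Lemma mark_arc_inhab (y : 'I_4 * 'I_4 * 'I_4 * nat) : mark_arc p y !=set0.
Proof. by exists (edge_point y.1.1.1 y.1.1.2 (p y.1.1.1 y.1.1.2)`_y.2); exact: segmentl. Qed.

Lemma face_arcs_disj f A A' : face_arcs p f A -> face_arcs p f A' -> A <> A' ->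
  A `&` A' = set0.
Proof.
move=> [a [b [c [i [u4 ic ->]]]]] [a' [b' [c' [j [u4' jc ->]]]]] ne.
apply: (mark_arc_disj u4 ic u4' jc) => -[aa ij]; apply: ne; subst a' j.
have := u4; rewrite uniq4E => /and5P[fa fb fc ab /andP[ac bc]].
have [[-> ->]|[-> ->]] : (b' = b /\ c' = c) \/ (b' = c /\ c' = b); [|by []|by rewrite mark_arcC].
move: u4'; rewrite uniq4E.
by case: (uniq4_mem b' u4) => ->; rewrite ?eqxx ?andbF //;
   case: (uniq4_mem c' u4) => ->; rewrite ?eqxx ?andbF //; auto.
Qed.

Lemma face_arcsE f :
  face_arcs p f = mark_arc p @` [set` face_index (weights p) f].
Proof.
apply/seteqP; split=> A.
  move=> [a [b [c [i [u4 ic ->]]]]].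
  have [cf|cf] := corners_of u4.
    by exists (a, b, c, i); rewrite //= mem_face_index cf.
  exists (a, c, b, i); last by rewrite mark_arcC.
  by rewrite /= mem_face_index cf (corner_countC B u4).
move=> [[[[a b] c] i]]; rewrite /= mem_face_index => /andP[/mem_corners u4 ic] <-.
by exists a, b, c, i.
Qed.

Lemma mark_arc_inj f : {in face_index (weights p) f &, injective (mark_arc p)}.
Proof.
move=> [[[a b] c] i] [[[a' b'] c'] j]; rewrite !mem_face_index.
move=> /andP[cf ic] /andP[cf' jc] E.
have [[aa ij]|ne] := pselect ((a, i) = (a', j)).
  by subst a' j; have [-> ->] := corners_fst_inj cf cf'.
have := mark_arc_disj (mem_corners cf) ic (mem_corners cf') jc ne.
by rewrite E setIid => E0; have [x] := mark_arc_inhab (a', b', c', j); rewrite E0.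
Qed.

Lemma card_face_arcs f : (face_arcs p f #= `I_(size (face_index (weights p) f)))%card.
Proof.
have fI : (face_arcs p f #= [set` face_index (weights p) f])%card.
  rewrite face_arcsE; apply: inj_card_eq => x y; rewrite !inE; exact: mark_arc_inj.
exact: card_eq_trans fI (card_seq (face_index_uniq _ _)).
Qed.

(** Every marked point is used: the first points of ab by the arcs at a, and
    all other ones by the arcs at b. *)
Lemma face_arcs_marks f a b c x : uniq [:: f; a; b; c] -> 0 < x < 1 ->
  x \in p a b <-> exists2 A, face_arcs p f A & A (edge_point a b x).
Proof.
move=> u4 x01; have := u4; rewrite uniq4E => /and5P[fa fb fc ab /andP[ac bc]]; split.
  move=> /(nthP 0)[i ip <-].
  have [ic|ic] := ltnP i (cnt a b c).
    by exists (mark_arc p (a, b, c, i)); [exists a, b, c, i|exact: segmentl].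
  pose j := (size (p a b) - i.+1)%N; have jc : (j < cnt b a c)%N.
    exact: rev_index_ltD (mark_sizeE u4) ic ip.
  exists (mark_arc p (b, a, c, j)); first by exists b, a, c, j; split=> //; exact: uniq4_bac.
  have -> : edge_point a b (p a b)`_i = edge_point b a (p b a)`_j; last exact: segmentl.
  have jp : (j < size (p a b))%N by exact: rev_index_lt.
  rewrite -edge_point_sym (mark_nth_rev ab) // /j.
  by rewrite rev_indexK.
move=> [A [a' [b' [c' [i [u4' ic ->]]]]]]; rewrite /mark_arc /=.
have [bi1 bi2] := mark_corner_bounds u4' ic; have [ip1 ip2] := mark_corner u4' ic.
have := u4'; rewrite uniq4E => /and5P[_ _ _ ab' /andP[ac' _]].
move=> xA; have xab : open_edge (edge_of a b) (edge_point a b x).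
  by apply/open_edgeP => //; exists x.
have in_ab d e y : d != e -> y \in p d e -> 0 < y < 1 ->
    edge_point a b x = edge_point d e y -> x \in p a b.
  move=> de yp y01 /(edge_point_eq ab de x01 y01)[[da eb <-]|[da eb yE]]; first by rewrite -da -eb.
  by rewrite mem_mark_rev // -yE -da -eb.
by case: (corner_arc_open_edge u4' bi1 bi2 xA xab);
  [apply: (in_ab _ _ _ ab')|apply: (in_ab _ _ _ ac')] => //; exact: mem_nth.
Qed.

End TetraMarking.

(** * The drawn arcs form cycles on the boundary of a tetrahedron *)

Section Darts.
Local Open Scope ring_scope.
Local Open Scope classical_set_scope.
Variable R : realType.
Implicit Types (f a b c : 'I_4) (i j : nat) (u v x y w z : R).

Variable p : 'I_4 -> 'I_4 -> seq R.
Hypothesis pM : tetra_marking p.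

Let cnt := corner_count (weights p).
Let B := mark_balanced pM.

Local Notation dart := ('I_4 * 'I_4 * 'I_4 * 'I_4 * nat)%type.

(** A dart (f, a, b, c, i) stands for one end of an arc: the arc is the i-th one
    at the corner a of the face opposite to f, and the end is the one on ab. *)
Definition is_dart (d : dart) : bool :=
  let: (f, a, b, c, i) := d in
  uniq [:: f; a; b; c] && (i < corner_count (weights p) a b c)%N.

Definition dart_seq : seq dart :=
  [seq d <- [seq (q, i) | q <- enum {: 'I_4 * 'I_4 * 'I_4 * 'I_4},
               i <- iota 0 (corner_count (weights p) q.1.1.2 q.1.2 q.2)] | is_dart d].

Lemma mem_dart_seq d : (d \in dart_seq) = is_dart d.
Proof.
rewrite mem_filter andb_idr //; case: d => [[[[f a] b] c] i] /andP[_ ic].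
by apply/allpairsPdep; exists (f, a, b, c), i; rewrite mem_enum mem_iota.
Qed.

Definition dart_other_end (d : dart) :=
  let: (f, a, b, c, i) := d in (f, a, c, b, i).

(** The face on the other side of ab is opposite to c.  The i-th point of ab
    counted from a belongs there to an arc at a or at b, and in the latter case
    it has to be counted from b. *)
Definition dart_other_face (d : dart) :=
  let: (f, a, b, c, i) := d in
  if (i < corner_count (weights p) a b f)%N then (c, a, b, f, i)
  else (c, b, a, f, (size (p a b) - i.+1)%N).

Definition dart_point (d : dart) : 'rV[R]_4 :=
  let: (f, a, b, c, i) := d in edge_point a b (p a b)`_i.

Lemma dart_other_endP d : is_dart d -> is_dart (dart_other_end d).
Proof.
case: d => [[[[f a] b] c] i] /andP[u4 ic] /=; rewrite (corner_countC B u4) ic andbT.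
exact: uniq4_acb.
Qed.

Lemma dart_other_endK : involutive dart_other_end.
Proof. by case=> [[[[f a] b] c] i]. Qed.

Lemma dart_other_faceP d : is_dart d -> is_dart (dart_other_face d).
Proof.
case: d => [[[[f a] b] c] i] /andP[u4 ic] /=; have u4' := uniq4_flip u4.
case: ifP => [ic'|/negbT]; first by apply/andP.
rewrite -leqNgt => ic'; apply/andP; split; first exact: uniq4_bac.
apply: rev_index_ltD (mark_sizeE pM u4') ic' _; exact: (mark_corner pM u4 ic).1.
Qed.

Lemma dart_other_faceK d : is_dart d -> dart_other_face (dart_other_face d) = d.
Proof.
case: d => [[[[f a] b] c] i] /andP[u4 ic] /=; have u4' := uniq4_flip u4.
case: ifP => [ic'|/negbT] /=; first by rewrite ic.
have ip := (mark_corner pM u4 ic).1; rewrite -leqNgt => ic'.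
have := u4; rewrite uniq4E => /and5P[_ _ _ ab _].
rewrite (mark_size_sym pM ab) rev_indexK // ifN // -leqNgt.
by have := mark_sizeE pM u4; move: ic ip; rewrite /cnt /weights; lia.
Qed.

Lemma dart_point_other_face d :
  is_dart d -> dart_point (dart_other_face d) = dart_point d.
Proof.
case: d => [[[[f a] b] c] i] /andP[u4 ic] /=.
have ip := (mark_corner pM u4 ic).1.
have := u4; rewrite uniq4E => /and5P[_ _ _ ab _].
case: ifP => //= _; rewrite -edge_point_sym (mark_nth_rev pM ab); last exact: rev_index_lt.
by rewrite subKr rev_indexK.
Qed.

(** Every marked point is the end of exactly two arcs, one in each face
    at its edge. *)
Lemma dart_point_eq d d' : is_dart d -> is_dart d' -> dart_point d = dart_point d' ->
  d' = d \/ d' = dart_other_face d.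
Proof.
case: d d' => [[[[f a] b] c] i] [[[[f' a'] b'] c'] j] /andP[u4 ic] /andP[u4' jc] /= E.
have ip := (mark_corner pM u4 ic).1; have jp := (mark_corner pM u4' jc).1.
have bi := (mark_corner_bounds pM u4 ic).1; have bj := (mark_corner_bounds pM u4' jc).1.
have := u4; rewrite uniq4E => /and5P[_ _ fc ab _].
have := u4'; rewrite uniq4E => /and5P[_ _ fc' ab' _].
have fcE : a' = a /\ b' = b \/ a' = b /\ b' = a -> f' = f /\ c' = c \/ f' = c /\ c' = f.
  move=> e; have := u4'; rewrite uniq4E => /and5P[+ + _ _ /andP[+ +]].
  case: (uniq4_mem f' u4) fc' => ->; case: (uniq4_mem c' u4) => ->; rewrite ?eqxx //;
  by case: e => [[-> ->]|[-> ->]]; rewrite ?eqxx //; auto.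
case: (edge_point_eq ab ab' bi bj E) => -[aE bE xE]; subst a' b'.
  have ij : i = j by apply: (mark_nth_inj pM ab).
  subst j; case: fcE => [|[-> ->]|[fE cE]]; [by left|by left|].
  by right; subst f' c'; rewrite jc.
have jE : j = (size (p a b) - i.+1)%N.
  apply: (mark_nth_inj pM ab'); rewrite ?(mark_size_sym pM ab) //.
  - by rewrite -(mark_size_sym pM ab).
  - exact: rev_index_lt.
  - by rewrite xE (mark_nth_rev pM ab) ?rev_indexK //; exact: rev_index_lt.
case: fcE => [|[fE cE]|[fE cE]]; first by right.
  subst f' c'; move: jc; rewrite jE; have := mark_sizeE pM u4.
  by move: ic ip; rewrite /cnt /weights; lia.
right; subst f' c'; rewrite ifN -?jE // -leqNgt.
have := mark_sizeE pM (uniq4_flip u4); move: jc ip; rewrite jE /cnt /weights; lia.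
Qed.

(** By [cycles_of_involutions] for darts.  A cycle cannot have length 1 or 2:
    leaving the face f along an arc which ends on the edge off the vertices f and
    b, one enters the face opposite to b, and from there the face opposite to a
    or c, which is not the face f. *)
Lemma tetra_cycles : exists cs : seq (seq 'rV[R]_4),
  [/\ all (fun s => 2 < size s)%N cs, uniq (flatten cs) &
      \bigcup_f face_arcs p f =
        [set A | exists s q, [/\ s \in cs, q \in s & A = segment q (next s q)]]].
Proof.
pose D := seq_sub dart_seq.
have DP (d : D) : is_dart (val d) by rewrite -mem_dart_seq; exact: valP.
pose rho (d : D) : D := insubd d (dart_other_end (val d)).
pose tau (d : D) : D := insubd d (dart_other_face (val d)).
have rhoE d : val (rho d) = dart_other_end (val d).
  by rewrite val_insubd mem_dart_seq dart_other_endP.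
have tauE d : val (tau d) = dart_other_face (val d).
  by rewrite val_insubd mem_dart_seq dart_other_faceP.
have segE (d : D) : segment (dart_point (val d)) (dart_point (val (rho d))) =
    let: (f, a, b, c, i) := val d in mark_arc p (a, b, c, i).
  by rewrite rhoE; case: (val d) => [[[[f a] b] c] i].
have [] := @cycles_of_involutions D _ rho tau (fun d => dart_point (val d)).
- by move=> d; apply: val_inj; rewrite !rhoE dart_other_endK.
- by move=> d; apply: val_inj; rewrite !tauE dart_other_faceK.
- move=> d; rewrite -(inj_eq val_inj) rhoE; case: (val d) (DP d) => [[[[f a] b] c] i].
  move=> /andP[+ _]; rewrite uniq4E /= => /and5P[_ _ _ _ /andP[_ bc]].
  by rewrite !xpair_eqE (eq_sym c) (negPf bc) !andbF.
- move=> d; rewrite -(inj_eq val_inj) tauE; case: (val d) (DP d) => [[[[f a] b] c] i].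
  move=> /andP[+ _]; rewrite uniq4E /= => /and5P[_ _ fc _ _].
  by case: ifP; rewrite !xpair_eqE (eq_sym c) (negPf fc).
- by move=> d; rewrite tauE dart_point_other_face.
- move=> d e; move=> /(dart_point_eq (DP d) (DP e))[?|?]; [left|right]; apply: val_inj => //.
  by rewrite tauE.
- move=> d; rewrite -(inj_eq val_inj) tauE rhoE; case: (val d) (DP d) => [[[[f a] b] c] i].
  move=> /andP[+ _]; rewrite uniq4E /= => /and5P[_ fb _ _ _].
  by case: ifP; rewrite !xpair_eqE (eq_sym b) (negPf fb).
- move=> d; rewrite -(inj_eq val_inj) tauE rhoE tauE rhoE.
  case: (val d) (DP d) => [[[[f a] b] c] i].
  move=> /andP[+ _]; rewrite uniq4E /= => /and5P[fa _ fc _ _].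
  by case: ifP => _ /=; case: ifP => _;
    rewrite !xpair_eqE !(eq_sym a f, eq_sym c f) ?(negPf fa, negPf fc).
move=> cs [cs2 csu cs_dart dart_cs]; exists cs; split=> //.
apply/seteqP; split=> A.
  move=> [f _ [a [b [c [i [u4 ic ->]]]]]].
  have dD : (f, a, b, c, i) \in dart_seq by rewrite mem_dart_seq; apply/andP.
  have [C [q [CC qC qE]]] := dart_cs (SeqSub dD); exists C, q; split=> //.
  have := segE (SeqSub dD); case: qE => -[-> ->] /=; last by rewrite segmentC => ->.
  by move=> ->.
move=> [C [q [CC qC ->]]]; have [d [-> ->]] := cs_dart C q CC qC.
rewrite segE; case: (val d) (DP d) => [[[[f a] b] c] i] /andP[u4 ic].
by exists f => //; exists a, b, c, i.
Qed.

End Darts.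

(** * Markings of the whole triangulation *)

Section Marking.
Local Open Scope ring_scope.
Local Open Scope classical_set_scope.
Local Open Scope card_scope.
Variables (R : realType) (n : nat) (T : gluing n).
Implicit Types (f a b c : 'I_4) (i j : nat) (u v x y w z : R) (t : 'I_n).

Record marking (pos : 'I_n -> 'I_4 -> 'I_4 -> seq R) : Prop := Marking {
  marking_tetra : forall t, tetra_marking (pos t);
  marking_glue : forall t f a b, f != a -> f != b -> a != b ->
    pos (mate T (t, f)).1 (gperm T (t, f) a) (gperm T (t, f) b) = pos t a b
}.

Definition arcs_of (pos : 'I_n -> 'I_4 -> 'I_4 -> seq R) : arc_family n R :=
  fun t f => face_arcs (pos t) f.

Variable pos : 'I_n -> 'I_4 -> 'I_4 -> seq R.
Hypothesis posM : marking pos.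

(** Gluing preserves the distances of marked points from the corner, and
    so maps the i-th arc at a corner to the i-th arc at the image of the corner. *)
Lemma glue_mark_arc t f a b c i : uniq [:: f; a; b; c] ->
  let g := gperm T (t, f) in let t' := (mate T (t, f)).1 in
  relabel g @` mark_arc (pos t) (a, b, c, i) = mark_arc (pos t') (g a, g b, g c, i) /\
  corner_count (weights (pos t')) (g a) (g b) (g c) = corner_count (weights (pos t)) a b c.
Proof.
rewrite uniq4E => /and5P[fa fb fc ab /andP[ac bc]] /=.
by rewrite /mark_arc /corner_count /weights /= relabel_corner_arc !marking_glue.
Qed.

Lemma arcs_of_system : arc_system T (arcs_of pos).
Proof.
move=> t f; have M := marking_tetra posM t; split.
- apply/finite_setP; exists (size (face_index (weights (pos t)) f)); exact: card_face_arcs.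
- by move=> A; exact: face_arcs_normal.
- by move=> A A'; exact: face_arcs_disj.
rewrite /= /arcs_of -(gperm_opp T (t, f)) /=; set g := gperm T (t, f).
apply/seteqP; split=> A.
  move=> [a [b [c [i [u4 ic ->]]]]].
  move: u4 ic; rewrite -(permKV g a) -(permKV g b) -(permKV g c) uniq4_perm => u4.
  have [E1 ->] := glue_mark_arc t i u4 => ic.
  rewrite -E1; apply: imageP.
  by exists ((g^-1)%g a), ((g^-1)%g b), ((g^-1)%g c), i.
move=> [_ [a [b [c [i [u4 ic ->]]]]] <-]; have [-> E] := glue_mark_arc t i u4.
by exists (g a), (g b), (g c), i; rewrite uniq4_perm E.
Qed.

Lemma arcs_of_cycles : forms_cycles (arcs_of pos).
Proof. by move=> t; exact: tetra_cycles (marking_tetra posM t). Qed.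

(** The number of arcs in a triangle is half the number of marked points on its
    sides. *)
Lemma at_most_arcs_of k : at_most_arcs_per_triangle k (arcs_of pos) <->
  forall t f a b c, uniq [:: f; a; b; c] ->
    (size (pos t a b) + size (pos t a c) + size (pos t b c) <= k.*2)%N.
Proof.
have cardE t f := card_face_arcs (marking_tetra posM t) f.
have sizeE t f a b c := size_face_index (mark_balanced (marking_tetra posM t)) (f := f)
  (a := a) (b := b) (c := c).
split=> [H t f a b c u4|H t f].
  have := H t f; rewrite /arcs_of (card_le_eql (cardE t f)) card_le_II.
  by rewrite -leq_double (sizeE t f a b c u4).
rewrite /arcs_of (card_le_eql (cardE t f)) card_le_II -leq_double.
by rewrite (sizeE t f _ _ _ (corners_uniq4 f)); exact: H (corners_uniq4 f).
Qed.

Lemma arcs_of_edge t a b : a != b ->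
  (\bigcup_(A in boundary_arcs (arcs_of pos) t) A) `&` open_edge (edge_of a b) =
  edge_point a b @` [set` pos t a b].
Proof.
move=> ab; have M := marking_tetra posM t; apply/seteqP; split=> p.
  move=> [[A [f _ Af] Ap]] /(open_edgeP _ ab)[x x01 pE]; subst p; exists x => //=.
  have [fa fb] := normal_arc_edge ab x01 (face_arcs_normal M Af) Ap.
  have [c' u4'] := uniq4_face fa fb ab.
  by apply/(face_arcs_marks M u4' x01); exists A.
move=> [x /= xp <-]; have x01 := mark_bounds M ab xp.
have [f [c u4]] := uniq4_edge ab.
have [A Af Ap] := (face_arcs_marks M u4 x01).1 xp.
by split; [exists A => //; exists f|apply/(open_edgeP _ ab); exists x].
Qed.

Lemma card_arcs_of_edge t a b : a != b ->
  (\bigcup_(A in boundary_arcs (arcs_of pos) t) A) `&` open_edge (edge_of a b)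
    #= `I_(size (pos t a b)).
Proof.
move=> ab; rewrite arcs_of_edge //.
have h : edge_point a b @` [set` pos t a b] #= [set` pos t a b].
  by apply: inj_card_eq => x y _ _; exact: edge_point_inj.
apply: card_eq_trans h (card_seq _).
exact: (sorted_uniq lt_trans ltxx (mark_sorted (marking_tetra posM t) ab)).
Qed.

End Marking.

(** * Every closed system of arcs is drawn from a marking *)

Section SystemPreliminaries.
Local Open Scope ring_scope.
Local Open Scope classical_set_scope.
Local Open Scope card_scope.
Variables (R : realType) (n : nat) (T : gluing n).
Implicit Types (f a b c : 'I_4) (i j : nat) (x y : R) (t : 'I_n).

Lemma corner_arc_inj f a b c (u v : R * R) : uniq [:: f; a; b; c] ->
  0 < u.1 < 1 -> 0 < u.2 < 1 -> 0 < v.1 < 1 -> 0 < v.2 < 1 ->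
  corner_arc a b c u.1 u.2 = corner_arc a b c v.1 v.2 -> u = v.
Proof.
move=> u4 u1 u2 v1 v2 E; apply: injective_projections.
  by apply/(corner_arc_edge u4 v1 v2 u1); rewrite -E; exact: segmentl.
apply/(corner_arc_edge (uniq4_acb u4) v2 v1 u2).
by rewrite -corner_arcC -E corner_arcC; exact: segmentl.
Qed.

Lemma relabel_inj (s : 'S_4) : injective (@relabel R s).
Proof.
by move=> x y /rowP E; apply/rowP=> j; have := E (s j); rewrite !mxE permK.
Qed.

(** This makes the two segments of a cycle which meet at q different sets. *)
Lemma next_neq_prev (V : eqType) (s : seq V) q :
  uniq s -> (2 < size s)%N -> q \in s ->
  [/\ next s q != prev s q, q != prev s q & q != next s q].
Proof.
move=> us s2 qs; have [k s' E] := rot_to qs.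
rewrite -(next_rot k us) -(prev_rot k us).
have {us} : uniq (rot k s) by rewrite rot_uniq.
have {s2} : (2 < size (rot k s))%N by rewrite size_rot.
rewrite {}E; case: s' => [|y [|z s']] // _ /andP[q_notin /andP[y_notin _]].
have pl : prev [:: q, y, z & s'] q = last z s'.
  rewrite prev_nth mem_head memNindex //= -[RHS]/(last q [:: q, y, z & s']).
  by rewrite (last_nth q).
have lz : last z s' \in z :: s' by exact: mem_last.
have -> : next [:: q, y, z & s'] q = y by rewrite /= eqxx.
rewrite pl; split.
- by apply: contraNneq y_notin => ->.
- by apply: contraNneq q_notin => {1}->; rewrite inE lz orbT.
- by apply: contraNneq q_notin => {1}->; rewrite mem_head.
Qed.

End SystemPreliminaries.

Local Open Scope ring_scope.
Local Open Scope classical_set_scope.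

Definition corner_set {R : realType} {n : nat} (S : arc_family n R) (t : 'I_n)
    (f a b c : 'I_4) : set (R * R) :=
  [set u | [/\ 0 < u.1 < 1, 0 < u.2 < 1 & S t f (corner_arc a b c u.1 u.2)]].

HB.lock Definition corner_seq {R : realType} {n : nat} (S : arc_family n R) (t : 'I_n)
    (f a b c : 'I_4) : seq (R * R) :=
  sort (fun u v : R * R => u.1 <= v.1)
    (finmap.enum_fset (fset_set (corner_set S t f a b c))).

Definition edge_set {R : realType} {n : nat} (S : arc_family n R) (t : 'I_n)
    (a b : 'I_4) : set R :=
  [set x | 0 < x < 1 /\ (\bigcup_(A in boundary_arcs S t) A) (edge_point a b x)].

HB.lock Definition system_pos {R : realType} {n : nat} (S : arc_family n R) (t : 'I_n)
    (a b : 'I_4) : seq R :=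
  sort <=%R (finmap.enum_fset (fset_set (edge_set S t a b))).

Local Close Scope classical_set_scope.
Local Close Scope ring_scope.

Section SystemToMarking.
Local Open Scope ring_scope.
Local Open Scope classical_set_scope.
Local Open Scope card_scope.
Variables (R : realType) (n : nat) (T : gluing n).
Implicit Types (f a b c : 'I_4) (i j : nat) (x y : R) (t : 'I_n).
Variable S : arc_family n R.
Hypothesis Ssys : arc_system T S.
Hypothesis Scyc : forms_cycles S.

Lemma system_disj t f A A' : S t f A -> S t f A' -> A `&` A' !=set0 -> A = A'.
Proof.
move=> SA SA' [q qAA]; apply: contrapT => ne; have [_ _ D _] := Ssys t f.
by move: qAA; rewrite (D _ _ SA SA' ne).
Qed.

(** The distances of the ends determine the arc. *)
Lemma corner_set_finite t f a b c : uniq [:: f; a; b; c] ->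
  finite_set (corner_set S t f a b c).
Proof.
move=> u4; have [fin _ _ _] := Ssys t f.
pose h (u : R * R) := corner_arc a b c u.1 u.2.
rewrite -(@eq_finite_set _ _ (h @` corner_set S t f a b c)).
  by apply: sub_finite_set fin => _ [u [_ _ ?] <-].
apply: inj_card_eq => x y; rewrite !in_setE => -[x1 x2 _] [y1 y2 _].
  exact: (corner_arc_inj u4).
Qed.

Lemma mem_corner_seq t f a b c u : uniq [:: f; a; b; c] ->
  u \in corner_seq S t f a b c <-> corner_set S t f a b c u.
Proof.
move=> u4; rewrite corner_seq.unlock mem_sort in_fset_set; last exact: corner_set_finite.
by rewrite inE.
Qed.

(** The list is sorted by the first distance only; the second one is sorted as
    well because unnested arcs meet. *)
Lemma corner_seq_sorted t f a b c : uniq [:: f; a; b; c] ->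
  pairwise (fun u v : R * R => (u.1 < v.1) && (u.2 < v.2)) (corner_seq S t f a b c).
Proof.
move=> u4; pose e (u v : R * R) := u.1 <= v.1.
have e_sorted : pairwise e (corner_seq S t f a b c).
  rewrite -sorted_pairwise; last by move=> x y z; exact: le_trans.
  by rewrite corner_seq.unlock; apply: sort_sorted => x y; exact: le_total.
have ne_sorted : pairwise (fun u v => u != v) (corner_seq S t f a b c).
  by rewrite -uniq_pairwise corner_seq.unlock sort_uniq; exact: finmap.fset_uniq.
have : pairwise [rel u v | e u v && (u != v)] (corner_seq S t f a b c).
  by rewrite pairwise_relI e_sorted ne_sorted.
apply: (sub_in_pairwise (P := mem (corner_seq S t f a b c))); last exact/allP.
move=> u v /(mem_corner_seq _ _ u4)[u1 u2 Su] /(mem_corner_seq _ _ u4)[v1 v2 Sv] /=.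
rewrite /e => /andP[uv /eqP ne].
have nomeet : ~ (corner_arc a b c u.1 u.2 `&` corner_arc a b c v.1 v.2 !=set0).
  by move/(system_disj Su Sv)/(corner_arc_inj u4 u1 u2 v1 v2).
have uv2 : u.2 < v.2.
  by rewrite ltNge; apply/negP=> vu; apply: nomeet; apply: (unnested_arcs_meet u4) => //; lra.
rewrite uv2 andbT ltNge; apply/negP=> vu; apply: nomeet.
by rewrite setIC; apply: (unnested_arcs_meet u4) => //; lra.
Qed.

(** Otherwise the two arcs meet by [overlapping_arcs_meet], hence they are equal;
    but an arc around b avoids the side ac opposite to b. *)
Lemma corner_seq_cross t f a b c u v : uniq [:: f; a; b; c] ->
  u \in corner_seq S t f a b c -> v \in corner_seq S t f b a c -> u.1 + v.1 < 1.
Proof.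
move=> u4 /(mem_corner_seq _ _ u4)[u1 u2 Su].
move=> /(mem_corner_seq _ _ (uniq4_bac u4))[v1 v2 Sv].
rewrite ltNge; apply/negP=> uv.
have := system_disj Su Sv (overlapping_arcs_meet u4 u1 u2 v1 v2 uv) => E.
have := corner_arc_opposite (x := u.2) (uniq4_bac u4) v1 v2; apply.
by rewrite -E; exact: segmentr.
Qed.

(** A cycle through q contains two different arcs with the common end q.
    Arcs of the same face are disjoint, so that these two arcs lie in different
    faces at the edge ab, and thus in both of them. *)
Lemma arc_other_face t f a b c q : uniq [:: f; a; b; c] ->
  open_edge (edge_of a b) q ->
  (exists2 A, S t f A & A q) -> (exists2 A, S t c A & A q).
Proof.
move=> u4 qab [A SA Aq]; have := u4; rewrite uniq4E => /and5P[fa fb fc ab /andP[ac bc]].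
have [x x01 qE] := (open_edgeP _ ab).1 qab.
have [cs [cs2 csu csE]] := Scyc t.
have normal f' A' : S t f' A' -> normal_arc f' A' by have [_ + _ _] := Ssys t f'; apply.
have [C [CC qC]] : exists C, C \in cs /\ q \in C.
  have : boundary_arcs S t A by exists f.
  rewrite csE => -[C [r [CC rC AE]]]; exists C; split=> //.
  have /normal_arcP[a' [b' [c' [u [v [u4' u01 v01 AE']]]]]] := normal _ _ SA.
  rewrite AE' in Aq AE; have := corner_arc_open_edge u4' u01 v01 Aq qab.
  by case: (segment_ends AE) => -[-> ->] [->|->]; rewrite ?mem_next.
have C2 : (2 < size C)%N by exact: (allP cs2).
have Cu : uniq C.
  have [l [r E]] : exists l r, cs = l ++ C :: r.
    by case/splitPr: CC => l r; exists l, r.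
  by move: csu; rewrite E flatten_cat cat_uniq /= cat_uniq => /and3P[_ _ /and3P[]].
have [np qp qn] := next_neq_prev Cu C2 qC.
have [f1 _ S1] : boundary_arcs S t (segment q (next C q)) by rewrite csE; exists C, q.
have [f2 _ S2] : boundary_arcs S t (segment (prev C q) q).
  by rewrite csE; exists C, (prev C q); rewrite mem_prev next_prev.
have faceE f' A' : S t f' A' -> A' q -> f' = f \/ f' = c.
  move=> /normal nA' A'q; rewrite qE in A'q.
  have := normal_arc_edge ab x01 nA' A'q.
  by case: (uniq4_mem f' u4) => ->; rewrite ?eqxx; auto; case.
have [f1E|f1E] := faceE _ _ S1 (segmentl _ _); last first.
  by exists (segment q (next C q)); [rewrite -f1E|exact: segmentl].
have [f2E|f2E] := faceE _ _ S2 (segmentr _ _); last first.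
  by exists (segment (prev C q) q); [rewrite -f2E|exact: segmentr].
subst f1 f2; have : segment q (next C q) = segment (prev C q) q.
  by apply: system_disj S1 S2 _; exists q; split; [exact: segmentl|exact: segmentr].
move=> /segment_ends[[/eqP qpE _]|[_ /eqP npE]]; first by rewrite qpE in qp.
by rewrite npE in np.
Qed.

(** By [arc_other_face], the points of intersection with an edge can be counted
    in any face at this edge. *)
Lemma edge_setP t f a b c x : uniq [:: f; a; b; c] ->
  edge_set S t a b x <-> 0 < x < 1 /\ exists2 A, S t f A & A (edge_point a b x).
Proof.
move=> u4; have := u4; rewrite uniq4E => /and5P[fa fb fc ab /andP[ac bc]].
split=> -[x01]; last by move=> [A SA Ax]; split=> //; exists A => //; exists f.
move=> [A [f' _ SA] Ax]; split=> //.
have xab : open_edge (edge_of a b) (edge_point a b x) by apply/(open_edgeP _ ab); exists x.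
have nA : normal_arc f' A by have [_ + _ _] := Ssys t f'; exact.
have := normal_arc_edge ab x01 nA Ax.
case: (uniq4_mem f' u4) => f'E; rewrite f'E ?eqxx; try by case.
  by move=> _; exists A => //; rewrite -f'E.
move=> _; apply: (arc_other_face (uniq4_flip u4) xab).
by exists A => //; rewrite -f'E.
Qed.

Lemma edge_set_corner t f a b c x : uniq [:: f; a; b; c] ->
  edge_set S t a b x <-> x \in [seq u.1 | u <- corner_seq S t f a b c] \/
                       1 - x \in [seq u.1 | u <- corner_seq S t f b a c].
Proof.
move=> u4; have u4b := uniq4_bac u4; rewrite (edge_setP t x u4).
have := u4; rewrite uniq4E => /and5P[fa fb fc ab /andP[ac bc]]; split; last first.
  case=> /mapP[u].
    move=> /(mem_corner_seq _ _ u4)[u1 u2 Su] ->; split=> //.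
    by exists (corner_arc a b c u.1 u.2) => //; exact: segmentl.
  move=> /(mem_corner_seq _ _ u4b)[u1 u2 Su] xE; split; first lra.
  by exists (corner_arc b a c u.1 u.2) => //; rewrite -edge_point_sym xE; exact: segmentl.
move=> [x01 [A SA Ax]].
have [_ /(_ _ SA)/normal_arcP[a' [b' [c' [u [v [u4' u01 v01 AE]]]]]] _ _] := Ssys t f.
have xab : open_edge (edge_of a b) (edge_point a b x) by apply/(open_edgeP _ ab); exists x.
rewrite {}AE in SA Ax.
(* The point is one of the two ends of the arc; up to reading the arc from
   its other end it is the first one. *)
wlog xu : b' c' u v u4' u01 v01 SA Ax / edge_point a b x = edge_point a' b' u.
  move=> H; case: (corner_arc_open_edge u4' u01 v01 Ax xab) => E; first exact: (H b' c' u v).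
  by rewrite corner_arcC in SA Ax; exact: (H c' b' v u (uniq4_acb u4') v01 u01).
have := u4'; rewrite uniq4E => /and5P[_ _ _ ab' _].
case: (edge_point_eq ab ab' x01 u01 xu) => -[aE bE uE]; subst a' b' u.
  have cE := uniq4_last u4 u4'; subst c'; left; apply/mapP; exists (x, v) => //.
  exact/(mem_corner_seq _ _ u4).
have cE := uniq4_last u4b u4'; subst c'; right; apply/mapP; exists (1 - x, v) => //.
exact/(mem_corner_seq _ _ u4b).
Qed.

Lemma system_pos_sorted t a b : sorted <%R (system_pos S t a b).
Proof.
by rewrite system_pos.unlock lt_sorted_uniq_le sort_uniq finmap.fset_uniq; exact: (sort_sorted le_total).
Qed.

(** On ab, the arcs around a come first and the arcs around b come last.  Both
    sides are strictly increasing lists with the same entries. *)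
Lemma system_pos_cat t f a b c : uniq [:: f; a; b; c] ->
  system_pos S t a b = [seq u.1 | u <- corner_seq S t f a b c] ++
                     rev [seq 1 - u.1 | u <- corner_seq S t f b a c].
Proof.
move=> u4; have u4' := uniq4_bac u4; set s := RHS.
have s_sorted : sorted <%R s.
  rewrite lt_sorted_pairwise pairwise_cat.
  rewrite pairwise_map; apply/and3P; split.
  - apply/allrelP => y z /mapP[u us ->]; rewrite mem_rev => /mapP[v vs ->].
    by have := corner_seq_cross u4 us vs; lra.
  - by apply: sub_pairwise (corner_seq_sorted t u4) => u v /andP[].
  rewrite -lt_sorted_pairwise rev_sorted sorted_pairwise; last first.
    by move=> y x z /= xy yz; exact: lt_trans yz xy.
  rewrite pairwise_map; apply: sub_pairwise (corner_seq_sorted t u4') => u v /andP[+ _] /=.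
  lra.
have sE : [set` s] = edge_set S t a b.
  apply/seteqP; split=> x /=; rewrite mem_cat mem_rev (edge_set_corner t x u4).
    case/orP=> [|/mapP[u us ->]]; first by left.
    by right; rewrite subKr map_f.
  case=> [->//|/mapP[u us xE]]; apply/orP; right; apply/mapP; exists u => //.
  by rewrite -xE subKr.
apply: lt_sorted_eq => //; first exact: system_pos_sorted.
move=> x; rewrite system_pos.unlock mem_sort -sE in_fset_set; last exact: finite_seq.
by apply/idP/idP; rewrite inE.
Qed.

Lemma eq_system_pos t a b t' a' b' :
  edge_set S t a b = edge_set S t' a' b' -> system_pos S t a b = system_pos S t' a' b'.
Proof. by rewrite system_pos.unlock => ->. Qed.

(** Exchanging b and c exchanges the two distances, and the list is sorted by
    both of them. *)
Lemma corner_seqC t f a b c : uniq [:: f; a; b; c] ->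
  [seq u.1 | u <- corner_seq S t f a c b] = [seq u.2 | u <- corner_seq S t f a b c].
Proof.
move=> u4; have u4' := uniq4_acb u4; apply: lt_sorted_eq.
- rewrite lt_sorted_pairwise pairwise_map.
  by apply: sub_pairwise (corner_seq_sorted t u4') => u v /andP[].
- rewrite lt_sorted_pairwise pairwise_map.
  by apply: sub_pairwise (corner_seq_sorted t u4) => u v /andP[].
move=> x; apply/mapP/mapP => -[[y z] us ->] /=; exists (z, y); try by [].
  apply/(mem_corner_seq _ _ u4); move: us => /(mem_corner_seq _ _ u4')[? ? ?].
  by split; rewrite //= corner_arcC.
apply/(mem_corner_seq _ _ u4'); move: us => /(mem_corner_seq _ _ u4)[? ? ?].
by split; rewrite //= corner_arcC.
Qed.

Lemma size_corner_seqC t f a b c : uniq [:: f; a; b; c] ->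
  size (corner_seq S t f a c b) = size (corner_seq S t f a b c).
Proof. by move=> /(corner_seqC t)/(congr1 size); rewrite !size_map. Qed.

Lemma size_system_pos t f a b c : uniq [:: f; a; b; c] ->
  size (system_pos S t a b) = (size (corner_seq S t f a b c) + size (corner_seq S t f b a c))%N.
Proof. by move=> u4; rewrite (system_pos_cat t u4) size_cat size_rev !size_map. Qed.

(** Each side of the triangle is divided between the arcs around its two ends,
    and the resulting three equations are solved for the numbers of arcs around
    the corners. *)
Lemma corner_count_system t f a b c : uniq [:: f; a; b; c] ->
  corner_count (weights (system_pos S t)) a b c = size (corner_seq S t f a b c).
Proof.
move=> u4; rewrite /corner_count /weights (size_system_pos t u4).
rewrite (size_system_pos t (uniq4_acb u4)).
rewrite (size_system_pos t (uniq4_acb (uniq4_bac u4))).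
rewrite (size_corner_seqC t u4) (size_corner_seqC t (uniq4_bac u4)).
rewrite -(size_corner_seqC t (uniq4_acb (uniq4_bac (uniq4_acb u4)))).
set p := size _; set q := size _; set r := size _.
by rewrite (_ : _ - _ = p.*2)%N ?doubleK //; lia.
Qed.

Lemma system_tetra_marking t : tetra_marking (system_pos S t).
Proof.
have rev_pos a b : a != b ->
    system_pos S t b a = rev [seq 1 - x | x <- system_pos S t a b].
  move=> /uniq4_edge[f [c u4]]; rewrite (system_pos_cat t u4) (system_pos_cat t (uniq4_bac u4)).
  rewrite map_cat rev_cat map_rev revK -!map_comp; congr (_ ++ _).
  by apply: eq_map => u /=; rewrite subKr.
split=> //.
- move=> a b x /uniq4_edge[f [c u4]]; rewrite (system_pos_cat t u4) mem_cat mem_rev.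
  case/orP=> /mapP[u us ->].
    by move: us => /(mem_corner_seq _ _ u4)[].
  by move: us => /(mem_corner_seq _ _ (uniq4_bac u4))[]; lra.
- move=> a b _; exact: system_pos_sorted.
split=> [a b ab|f a b c u4].
  by rewrite /weights (rev_pos _ _ ab) size_rev size_map.
rewrite (corner_count_system t u4) (corner_count_system t (uniq4_bac u4)).
exact: size_system_pos.
Qed.

Lemma system_marking : marking T (system_pos S).
Proof.
split=> [|t f a b fa fb ab]; first exact: system_tetra_marking.
have [c u4] := uniq4_face fa fb ab; apply: eq_system_pos; apply/seteqP.
have u4' : uniq [:: (mate T (t, f)).2; gperm T (t, f) a; gperm T (t, f) b;
                    gperm T (t, f) c].
  by rewrite -(gperm_opp T (t, f)) uniq4_perm.
have [_ _ _ /= SE] := Ssys t f.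
split=> x; rewrite (edge_setP _ _ u4) (edge_setP _ _ u4') -relabel_edge_point.
  move=> [x01 [A]]; rewrite SE => -[A' SA' <-] [q Aq /relabel_inj qE]; split=> //.
  by exists A' => //; rewrite -qE.
move=> [x01 [A SA Ax]]; split=> //; exists (relabel (gperm T (t, f)) @` A).
  by rewrite SE; exists A.
by exists (edge_point a b x).
Qed.

(** The i-th arc around a has the i-th distances from a on both sides, since the
    arcs around a come first on ab and on ac. *)
Lemma system_arcs_of : S = arcs_of (system_pos S).
Proof.
apply/funext=> t; apply/funext=> f; apply/seteqP; split=> A.
  move=> SA; have [_ /(_ _ SA)/normal_arcP[a [b [c [u [v [u4 u01 v01 AE]]]]]] _ _] := Ssys t f.
  have : (u, v) \in corner_seq S t f a b c.
    by apply/(mem_corner_seq _ _ u4); split=> //=; rewrite -AE.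
  move=> /(nthP (0, 0))[i ic uvE]; exists a, b, c, i.
  rewrite (corner_count_system t u4); split=> //.
  rewrite AE /mark_arc /= (system_pos_cat t u4) (system_pos_cat t (uniq4_acb u4)).
  rewrite !nth_cat !size_map (size_corner_seqC t u4) ic (corner_seqC t u4).
  by rewrite !(nth_map (0, 0)) // uvE.
move=> [a [b [c [i [u4 + ->]]]]]; rewrite (corner_count_system t u4) => ic.
rewrite /mark_arc /= (system_pos_cat t u4) (system_pos_cat t (uniq4_acb u4)).
rewrite !nth_cat !size_map (size_corner_seqC t u4) ic (corner_seqC t u4).
rewrite !(nth_map (0, 0)) //.
by have /(mem_corner_seq _ _ u4)[] := mem_nth (0, 0) ic.
Qed.

End SystemToMarking.

(** * Colours and numbers of points *)

Section Weights.
Local Open Scope nat_scope.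
Implicit Types (f a b c : 'I_4) (phi : 'I_4 -> 'I_4 -> nat).

(** The parity condition and the triangle inequalities are the conditions for
    (|ab| + |ac| - |bc|) / 2 to be a natural number. *)
Lemma balancedP phi : (forall a b, a != b -> phi b a = phi a b) ->
  balanced phi <-> forall f a b c, uniq [:: f; a; b; c] ->
    ~~ odd (phi a b + phi a c + phi b c) /\ phi a b <= phi a c + phi b c.
Proof.
move=> sym; have neqs f a b c : uniq [:: f; a; b; c] -> [/\ a != b, a != c & b != c].
  by rewrite uniq4E => /and5P[_ _ _ -> /andP[-> ->]].
split=> [[_ E] f a b c u4|H].
  have [ab ac bc] := neqs _ _ _ _ u4.
  have := E _ _ _ _ u4; have := E _ _ _ _ (uniq4_acb u4).
  have := E _ _ _ _ (uniq4_acb (uniq4_bac u4)); rewrite /corner_count.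
  rewrite (sym _ _ ab) (sym _ _ ac) (sym _ _ bc).
  move: (phi a b) (phi a c) (phi b c); lia.
split=> // f a b c u4; have [ab ac bc] := neqs _ _ _ _ u4.
have := H _ _ _ _ u4; have := H _ _ _ _ (uniq4_acb u4).
have := H _ _ _ _ (uniq4_acb (uniq4_bac u4)); rewrite /corner_count.
rewrite (sym _ _ ab) (sym _ _ ac) (sym _ _ bc).
move: (phi a b) (phi a c) (phi b c); lia.
Qed.

End Weights.

Section Colours.
Local Open Scope ring_scope.
Local Open Scope classical_set_scope.
Local Open Scope card_scope.
Local Open Scope quotient_scope.
Variables (n : nat) (T : gluing n) (r : nat).
Implicit Types (f a b c : 'I_4) (t : 'I_n) (theta : colouring T r).
Implicit Types P Q : {P : {set 'I_4} | #|P| == 2}.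

(** The k-th colour is k / 2, so that the index of a colour is twice the
    colour. *)
Definition colour_weight theta t a b : nat :=
  index (colour theta t (edge_of a b)) (colours r).

Lemma colour_weightP theta t a b :
  2 * colour theta t (edge_of a b) = (colour_weight theta t a b)%:R /\
  (colour_weight theta t a b < r.-1)%N.
Proof.
have cin : colour theta t (edge_of a b) \in colours r by exact: ssvalP.
have kr : (colour_weight theta t a b < r.-1)%N.
  by move: (cin); rewrite -index_mem size_map size_iota.
split=> //; have := nth_index 0 cin.
rewrite (nth_map 0%N) ?size_iota // nth_iota // add0n => <-.
by rewrite mulrC divfK.
Qed.

Lemma colour_weight_sym theta t a b :
  colour_weight theta t a b = colour_weight theta t b a.
Proof. by rewrite /colour_weight edge_ofC. Qed.

Lemma edge_class_glue t f a b : f != a -> f != b -> a != b ->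
  edge_class T ((mate T (t, f)).1, edge_of (gperm T (t, f) a) (gperm T (t, f) b)) =
  edge_class T (t, edge_of a b).
Proof.
move=> fa fb ab; apply/esym/eqmodP/asboolP; apply: rst_step; exists f; split=> //=.
  by rewrite in_edge_of // negb_or fa.
rewrite val_edge_of ?(inj_eq perm_inj) // val_edge_of //.
by rewrite imsetU1 imset_set1.
Qed.

Lemma colour_glue theta t f a b : f != a -> f != b -> a != b ->
  colour theta (mate T (t, f)).1 (edge_of (gperm T (t, f) a) (gperm T (t, f) b)) =
  colour theta t (edge_of a b).
Proof. by move=> fa fb ab; rewrite /colour edge_class_glue. Qed.

Lemma colouring_eq theta theta' :
  (forall t a b, a != b ->
     colour theta t (edge_of a b) = colour theta' t (edge_of a b)) ->
  theta = theta'.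
Proof.
move=> H; apply/funext=> e; apply: val_inj => /=.
have [a [b [ab E]]] := edge_ofP (repr e).2.
have := H (repr e).1 a b ab.
by rewrite /colour -E -surjective_pairing /edge_class reprK.
Qed.

Lemma half_int (k : nat) : (k%:R / 2 : rat) \is a Num.int = ~~ odd k.
Proof.
apply/idP/idP => [/intrP[z E]|ek].
  have : k%:Z = 2 * z.
    apply: (@intr_inj rat); rewrite intrM -E mulrC divfK //.
  lia.
by rewrite -[k]odd_double_half (negPf ek) add0n -muln2 natrM mulfK // natr_int.
Qed.

Lemma triangle_edges f P1 P2 P3 : uniq [:: P1; P2; P3] ->
  f \notin val P1 -> f \notin val P2 -> f \notin val P3 ->
  exists a b c, [/\ uniq [:: f; a; b; c], P1 = edge_of a b, P2 = edge_of a c &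
                   P3 = edge_of b c].
Proof.
have [a [b [ab ->]]] := edge_ofP P1; have [a2 [b2 [ab2 ->]]] := edge_ofP P2.
have [a3 [b3 [ab3 ->]]] := edge_ofP P3; rewrite !in_edge_of // !negb_or.
move=> + /andP[fa fb] /andP[fa2 fb2] /andP[fa3 fb3].
have [c u4] := uniq4_face fa fb ab.
move: (uniq4_mem a2 u4) (uniq4_mem b2 u4) (uniq4_mem a3 u4) (uniq4_mem b3 u4).
rewrite /= !inE !negb_or !andbT => m2 n2 m3 n3 /andP[/andP[h12 h13] h23].
have edges x y : x != y -> f != x -> f != y -> 
   [\/ x = f, x = a, x = b | x = c] -> [\/ y = f, y = a, y = b | y = c] ->
   edge_of a b != edge_of x y -> edge_of x y = edge_of a c \/ edge_of x y = edge_of b c.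
  move=> xy fx fy [] xE [] yE; subst x y; move: xy fx fy; rewrite ?eqxx // => _ _ _;
  by rewrite ?(edge_ofC c) ?(edge_ofC b a) ?eqxx //; auto.
have [e2|e2] := edges _ _ ab2 fa2 fb2 m2 n2 h12;
have [e3|e3] := edges _ _ ab3 fa3 fb3 m3 n3 h13; move: h23; rewrite e2 e3 ?eqxx // => _.
  by exists a, b, c.
by exists b, a, c; rewrite (edge_ofC b a); split=> //; exact: uniq4_bac.
Qed.

(** Admissibility in terms of the integers w = 2 theta; in this form it is
    compared with the numbers of points of a marking. *)
Lemma admissible_weights theta (w : 'I_n -> 'I_4 -> 'I_4 -> nat) :
  (forall t a b, a != b -> 2 * colour theta t (edge_of a b) = (w t a b)%:R) ->
  admissible theta <-> forall t f a b c, uniq [:: f; a; b; c] ->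
    [/\ ~~ odd (w t a b + w t a c + w t b c),
        (w t a b <= w t a c + w t b c)%N &
        (w t a b + w t a c + w t b c <= (r - 2).*2)%N].
Proof.
move=> wE; have cE t a b : a != b -> colour theta t (edge_of a b) = (w t a b)%:R / 2.
  by move=> /(wE t) <-; rewrite mulrC mulKf.
have key t f a b c : uniq [:: f; a; b; c] ->
  [/\ ~~ odd (w t a b + w t a c + w t b c),
      (w t a b <= w t a c + w t b c)%N &
      (w t a b + w t a c + w t b c <= (r - 2).*2)%N] <->
  let x := colour theta t (edge_of a b) in let y := colour theta t (edge_of a c) in
  let z := colour theta t (edge_of b c) in
  [/\ x + y + z \is a Num.int, x <= y + z & x + y + z <= (r - 2)%:R].
  rewrite uniq4E => /and5P[_ _ _ ab /andP[ac bc]] /=; rewrite !cE // -!mulrDl -!natrD.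
  rewrite half_int ler_pM2r ?invr_gt0 // ler_nat ler_pdivrMr // -natrM ler_nat muln2.
  by split=> -[].
split=> adm.
  move=> t f a b c u4; apply/(key _ _ _ _ _ u4).
  have := u4; rewrite uniq4E => /and5P[fa fb fc ab /andP[ac bc]].
  apply: (adm t f); last by rewrite !in_edge_of // !negb_or fa fb fc.
  have neq x y z : uniq [:: x; y; z] -> edge_of x y != edge_of x z.
    move=> /=; rewrite !inE negb_or !andbT => /andP[/andP[xy xz] yz].
    (* The vertex y is on the first edge only. *)
    apply: contraTneq isT => /(congr1 val)/setP/(_ y).
    by rewrite !in_edge_of // eqxx orbT (eq_sym y x) (negPf xy) (negPf yz).
  have N1 := neq a b c; have N2 := neq b a c; have N3 := neq c a b.
  rewrite /= !inE !negb_or !andbT.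
  rewrite (edge_ofC b a) in N2; rewrite (edge_ofC c a) (edge_ofC c b) in N3.
  rewrite N1 ?N2 ?N3 //= !inE !negb_or ?andbT ?(eq_sym b a, eq_sym c a, eq_sym c b) ?ab ?ac ?bc //.
move=> t f P1 P2 P3 uP [f1 f2 f3].
have [a [b [c [u4 -> -> ->]]]] := triangle_edges uP f1 f2 f3.
by apply/(key _ _ _ _ _ u4); exact: adm u4.
Qed.

End Colours.

(** * Systems of arcs corresponding to a colouring *)

Section Correspondence.
Local Open Scope ring_scope.
Local Open Scope classical_set_scope.
Local Open Scope card_scope.
Local Open Scope quotient_scope.
Variables (R : realType) (n : nat) (T : gluing n) (r : nat).
Implicit Types (f a b c : 'I_4) (t : 'I_n) (theta : colouring T r).
Implicit Types pos : 'I_n -> 'I_4 -> 'I_4 -> seq R.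

Lemma corresponds_arcs_of pos theta : marking T pos ->
  corresponds theta (arcs_of pos) <->
  forall t a b, a != b -> 2 * colour theta t (edge_of a b) = (size (pos t a b))%:R.
Proof.
move=> posM; split=> H t.
  move=> a b ab; have [phi [-> cardE]] := H t (edge_of a b).
  suff -> : phi = size (pos t a b) by [].
  apply/card_eq_II; apply: card_eq_trans (card_arcs_of_edge posM t ab).
  exact: card_esym.
move=> P; have [a [b [ab ->]]] := edge_ofP P; exists (size (pos t a b)).
by rewrite H //; split=> //; exact: (card_arcs_of_edge posM).
Qed.

Lemma marking_admissible pos theta : marking T pos ->
  (forall t a b, a != b -> 2 * colour theta t (edge_of a b) = (size (pos t a b))%:R) ->
  at_most_arcs_per_triangle (r - 2) (arcs_of pos) <-> admissible theta.
Proof.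
move=> posM wE; rewrite (at_most_arcs_of posM) (admissible_weights wE).
have bal t := mark_balanced (marking_tetra posM t).
split=> H t f a b c u4; last by have [] := H t f a b c u4.
by have [h1 h2] := (balancedP (bal t).1).1 (bal t) _ _ _ _ u4; split=> //; exact: H u4.
Qed.

(** Evenly spaced points form a list that is symmetric under reversal and
    depends on the number of points only.  Hence the points match under all
    gluings. *)
Definition even_positions (k : nat) : seq R := [seq i.+1%:R / k.+1%:R | i <- iota 0 k].

Lemma even_positions_marking (w : 'I_n -> 'I_4 -> 'I_4 -> nat) :
  (forall t, balanced (w t)) ->
  (forall t f a b, f != a -> f != b -> a != b ->
     w (mate T (t, f)).1 (gperm T (t, f) a) (gperm T (t, f) b) = w t a b) ->
  marking T (fun t a b => even_positions (w t a b)).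
Proof.
move=> bal glue; split=> [t|t f a b fa fb ab]; last by rewrite glue.
have sizeE k : size (even_positions k) = k by rewrite size_map size_iota.
have nthE k i : (i < k)%N -> (even_positions k)`_i = i.+1%:R / k.+1%:R.
  by move=> ik; rewrite (nth_map 0%N) ?size_iota // nth_iota.
have k0 (k : nat) : 0 < k.+1%:R :> R by rewrite ltr0n.
split.
- move=> a b x _ /mapP[i]; rewrite mem_iota add0n => ik ->.
  by rewrite divr_gt0 // ltr_pdivrMr // mul1r ltr_nat ltnS.
- move=> a b _; rewrite lt_sorted_pairwise; apply/(pairwiseP 0) => i j.
  rewrite !inE !sizeE => ik jk ij; rewrite !nthE // ltr_pM2r ?invr_gt0 //.
  by rewrite ltr_nat ltnS.
- move=> a b ab; rewrite ((bal t).1 a b ab); apply: (@eq_from_nth _ 0).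
    by rewrite size_rev [RHS]size_map.
  move=> i; rewrite sizeE => ik; rewrite nth_rev; rewrite size_map sizeE //.
  rewrite nthE // [RHS](nth_map 0) ?sizeE ?rev_index_lt // nthE ?rev_index_lt //.
  apply: (mulIf (lt0r_neq0 (k0 (w t a b)))); rewrite mulrBl mul1r !divfK ?lt0r_neq0 //.
  by rewrite -natrB; [congr (_%:R); lia|lia].
- by rewrite (_ : weights _ = w t) //; apply/funext=> a; apply/funext=> b; exact: sizeE.
Qed.

Lemma colouring_has_arcs theta : admissible theta ->
  exists S : arc_family n R, cyclic_arc_system T (r - 2) S /\ corresponds theta S.
Proof.
move=> adm; have wE t a b : a != b ->
   2 * colour theta t (edge_of a b) = (colour_weight theta t a b)%:R.
  by have [] := colour_weightP theta t a b.
have sym t a b : a != b -> colour_weight theta t b a = colour_weight theta t a b.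
  by rewrite colour_weight_sym.
have posM : marking T (fun t a b => even_positions (colour_weight theta t a b)).
  apply: even_positions_marking => [t|t f a b fa fb ab].
    apply/(balancedP (sym t)) => f a b c u4.
    by have [] := (admissible_weights wE).1 adm t f a b c u4.
  by rewrite /colour_weight colour_glue.
have posE t a b : a != b -> 2 * colour theta t (edge_of a b) =
    (size (even_positions (colour_weight theta t a b)))%:R.
  by move=> ab; rewrite size_map size_iota wE.
exists (arcs_of (fun t a b => even_positions (colour_weight theta t a b))).
split; last exact/corresponds_arcs_of.
split; [exact: arcs_of_system posM| |exact: arcs_of_cycles posM].
exact/(marking_admissible posM posE).
Qed.

(** The number of points is defined on the edges of the abstract tetrahedra.  It
    is invariant under each identification of edges, hence constant on the classes;
    and it is at most r - 2, because by the triangle inequality twice the number of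
    points on one side is at most the number on all three sides. *)
Lemma marking_colouring pos : (1 < r)%N -> marking T pos ->
  at_most_arcs_per_triangle (r - 2) (arcs_of pos) ->
  exists theta, forall t a b, a != b ->
    2 * colour theta t (edge_of a b) = (size (pos t a b))%:R.
Proof.
move=> r1 posM most.
have /choice[ends endsP] : forall P : {P : {set 'I_4} | #|P| == 2},
    exists ab : 'I_4 * 'I_4, ab.1 != ab.2 /\ P = edge_of ab.1 ab.2.
  by move=> P; have [a [b h]] := edge_ofP P; exists (a, b).
pose w (x : tetra_edge n) := size (pos x.1 (ends x.2).1 (ends x.2).2).
have wE t a b : a != b -> w (t, edge_of a b) = size (pos t a b).
  move=> ab; rewrite /w /=; case: (ends _) (endsP (edge_of a b)) => a' b' /= [ab' E].
  have : a \in val (edge_of a' b') /\ b \in val (edge_of a' b').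
    by rewrite -E !in_edge_of // !eqxx orbT.
  rewrite !in_edge_of // => -[/orP[]/eqP aE /orP[]/eqP bE]; subst a b; rewrite ?eqxx // in ab *.
  exact: (mark_size_sym (marking_tetra posM t)).
have w_ident x y : edge_identified T x y -> w x = w y.
  case: x y => [t P] [t' P'] [f [fP t'E P'E]].
  have {}fP : f \notin val P := fP; have {}t'E : t' = (mate T (t, f)).1 := t'E.
  have {}P'E : val P' = gperm T (t, f) @: val P := P'E; subst t'.
  have [a [b [ab PE]]] := edge_ofP P; subst P.
  have {P'E} -> : P' = edge_of (gperm T (t, f) a) (gperm T (t, f) b).
    apply: val_inj; rewrite P'E !val_edge_of ?(inj_eq perm_inj) //.
    by rewrite imsetU1 imset_set1.
  move: fP; rewrite in_edge_of // negb_or => /andP[fa fb].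
  by rewrite !wE ?(inj_eq perm_inj) // (marking_glue posM).
have w_class x y : equiv_closure (edge_identified T) x y -> w x = w y.
  move=> /asboolP; elim=> {x y} [x y|//|x y _ ->//|x y z _ -> _ ->//]; exact: w_ident.
have w_lt x : (w x < r.-1)%N.
  case: x => t P; have [a [b [ab ->]]] := edge_ofP P; rewrite wE //.
  have [f [c u4]] := uniq4_edge ab.
  have := (at_most_arcs_of posM _).1 most t f a b c u4.
  have bal := mark_balanced (marking_tetra posM t).
  have [_ ] := (balancedP bal.1).1 bal _ _ _ _ u4; rewrite /weights.
  move: (size _) (size _) (size _) => x y z; lia.
have w_in x : (w x)%:R / 2 \in colours r.
  by apply/mapP; exists (w x) => //; rewrite mem_iota /= add0n w_lt.
exists (fun e => SeqSub (w_in (repr e))) => t a b ab; rewrite /colour /=.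
rewrite mulrC divfK // -(wE t a b ab); congr (_%:R).
by apply: w_class; apply/eqmodP; exact: reprK.
Qed.

End Correspondence.

(** * Isotopy by interpolation *)

Section Isotopy.
Local Open Scope ring_scope.
Local Open Scope classical_set_scope.
Local Open Scope card_scope.
Variables (R : realType) (n : nat) (T : gluing n).
Implicit Types (f a b c : 'I_4) (t : 'I_n) (s : R).
Implicit Types pos : 'I_n -> 'I_4 -> 'I_4 -> seq R.

Lemma eq_face_index (phi phi' : 'I_4 -> 'I_4 -> nat) f :
  (forall a b, a != b -> phi a b = phi' a b) -> face_index phi f = face_index phi' f.
Proof.
move=> E; have := corners_uniq4 f; rewrite uniq4E => /and5P[_ _ _ xy /andP[xz yz]].
rewrite /face_index /corners /corner_count /=.
by rewrite !E // 1?eq_sym.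
Qed.

Lemma eq_balanced (phi phi' : 'I_4 -> 'I_4 -> nat) :
  (forall a b, a != b -> phi a b = phi' a b) -> balanced phi -> balanced phi'.
Proof.
move=> E [sym bal]; split=> [a b ab|f a b c u4].
  by rewrite -(E a b ab) -(E b a); [exact: sym|rewrite eq_sym].
have := u4; rewrite uniq4E => /and5P[_ _ _ ab /andP[ac bc]].
have ba : b != a by rewrite eq_sym.
by have := bal _ _ _ _ u4; rewrite /corner_count !E.
Qed.

Definition interpolate s (p q : seq R) : seq R :=
  [seq (1 - s) * u.1 + s * u.2 | u <- zip p q].

Lemma size_interpolate s p q : size p = size q -> size (interpolate s p q) = size p.
Proof. by move=> pq; rewrite size_map size_zip pq minnn. Qed.

Lemma nth_interpolate s p q i : size p = size q -> (i < size p)%N ->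
  (interpolate s p q)`_i = (1 - s) * p`_i + s * q`_i.
Proof.
by move=> pq ip; rewrite (nth_map (0, 0)) ?nth_zip // size_zip pq minnn -pq.
Qed.

Lemma interpolate0 p q : size p = size q -> interpolate 0 p q = p.
Proof.
move=> pq; apply: (@eq_from_nth _ 0); first exact: size_interpolate.
by move=> i; rewrite size_interpolate // => ip; rewrite nth_interpolate // subr0 mul1r mul0r addr0.
Qed.

Lemma interpolate1 p q : size p = size q -> interpolate 1 p q = q.
Proof.
move=> pq; apply: (@eq_from_nth _ 0); first by rewrite size_interpolate.
by move=> i; rewrite size_interpolate // => ip; rewrite nth_interpolate // subrr mul1r mul0r add0r.
Qed.

Lemma convex_lt s x x' y y' : 0 <= s <= 1 -> x < x' -> y < y' ->
  (1 - s) * x + s * y < (1 - s) * x' + s * y'.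
Proof.
move=> /andP[s0 s1] xx yy; have [->|s_neq0] := eqVneq s 0; first lra.
have : 0 <= (1 - s) * (x' - x) by apply: mulr_ge0; lra.
have : 0 < s * (y' - y) by rewrite mulr_gt0 ?subr_gt0 // lt_def s_neq0.
lra.
Qed.

(** Order, symmetry and compatibility with the gluings are preserved by convex
    combinations. *)
Lemma interpolate_marking s pos pos' : 0 <= s <= 1 -> marking T pos -> marking T pos' ->
  (forall t a b, a != b -> size (pos t a b) = size (pos' t a b)) ->
  marking T (fun t a b => interpolate s (pos t a b) (pos' t a b)).
Proof.
move=> s01 M M' E; split=> [t|t f a b fa fb ab]; last first.
  by rewrite (marking_glue M) // (marking_glue M').
have Mt := marking_tetra M t; have Mt' := marking_tetra M' t; split.
- move=> a b x ab /(nthP 0)[i]; rewrite size_interpolate ?E // => ip <-.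
  rewrite nth_interpolate ?E //.
  have /andP[x0 x1] : 0 < (pos t a b)`_i < 1 by apply: mark_nth_bounds; rewrite ?E.
  have /andP[y0 y1] : 0 < (pos' t a b)`_i < 1 by exact: mark_nth_bounds.
  have := convex_lt s01 x0 y0; have := convex_lt s01 x1 y1; lra.
- move=> a b ab; rewrite lt_sorted_pairwise; apply/(pairwiseP 0) => i j.
  rewrite !inE !size_interpolate ?E // => ip jp ij; rewrite !nth_interpolate ?E //.
  apply: convex_lt => //; first by apply: (mark_nth_lt Mt) => //; rewrite E.
  exact: (mark_nth_lt Mt').
- move=> a b ab; have ba : b != a by rewrite eq_sym.
  rewrite (mark_rev Mt ab) (mark_rev Mt' ab) /interpolate.
  rewrite -rev_zip ?size_map ?E // map_rev; congr (rev _).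
  elim: (pos t a b) (pos' t a b) => [|x p IH] [|y q] //=; rewrite IH; congr (_ :: _); ring.
apply: eq_balanced (mark_balanced Mt) => a b ab.
by rewrite /weights size_interpolate ?E.
Qed.

Lemma edge_point_continuous a b (g : R -> R) :
  continuous g -> continuous (fun s => edge_point a b (g s)).
Proof.
move=> cg s; rewrite /edge_point; apply: cvgD; apply: cvgZr_tmp; last exact: cg.
by apply: cvgB; [exact: cvg_cst|exact: cg].
Qed.

Lemma nth_interpolate_continuous (p q : seq R) i :
  continuous (fun s => (interpolate s p q)`_i).
Proof.
have [ip|ip] := ltnP i (size (zip p q)); last first.
  rewrite (_ : (fun s => _) = cst 0); first exact: cst_continuous.
  by apply/funext=> s; rewrite nth_default // size_map.
rewrite (_ : (fun s => _) = (fun s => (1 - s) * (nth (0, 0) (zip p q) i).1 +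
   s * (nth (0, 0) (zip p q) i).2)); last first.
  by apply/funext=> s; rewrite (nth_map (0, 0)).
move=> s; apply: cvgD; apply: cvgM; try exact: cvg_cst; last exact: cvg_id.
by apply: cvgB; [exact: cvg_cst|exact: cvg_id].
Qed.

(** The arcs of the interpolated markings are arcs of markings, so that they
    form a closed system at any time; they are enumerated by the same index
    at all times. *)
Lemma interpolate_isotopic pos pos' : marking T pos -> marking T pos' ->
  (forall t a b, a != b -> size (pos t a b) = size (pos' t a b)) ->
  normally_isotopic T (arcs_of pos) (arcs_of pos').
Proof.
move=> M M' E; pose pos_at s t a b := interpolate s (pos t a b) (pos' t a b).
have posM s : 0 <= s <= 1 -> marking T (pos_at s) by move=> s01; exact: interpolate_marking.
have eq_arcs p p' : (forall t a b, a != b -> p t a b = p' t a b) ->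
    arcs_of p = arcs_of p' :> arc_family n R.
  move=> pp; apply/funext=> t; apply/funext=> f; apply/seteqP; split=> A;
  move=> [a [b [c [i [u4 ic ->]]]]]; exists a, b, c, i; split=> //;
  move: u4 ic; rewrite uniq4E => /and5P[_ _ _ ab /andP[ac bc]];
  by rewrite /mark_arc /corner_count /weights /= !pp.
exists (fun s => arcs_of (pos_at s)); split.
- by apply: eq_arcs => t a b ab; apply: interpolate0; exact: E.
- by apply: eq_arcs => t a b ab; apply: interpolate1; exact: E.
- by move=> s /posM sM; split; [exact: arcs_of_system sM|exact: arcs_of_cycles sM].
move=> t f; pose ix := face_index (weights (pos t)) f.
pose y0 : 'I_4 * 'I_4 * 'I_4 * nat := (f, f, f, 0%N).
exists (size ix).
exists (fun i s => let y := nth y0 ix i in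
  edge_point y.1.1.1 y.1.1.2 (pos_at s t y.1.1.1 y.1.1.2)`_y.2).
exists (fun i s => let y := nth y0 ix i in
  edge_point y.1.1.1 y.1.2 (pos_at s t y.1.1.1 y.1.2)`_y.2).
split=> [i|s /posM sM].
  by split; apply: continuous_subspaceT; apply: edge_point_continuous;
    exact: nth_interpolate_continuous.
(* The numbers of points do not change with the time. *)
have ixE : face_index (weights (pos_at s t)) f = ix.
  by apply: eq_face_index => a b ab; rewrite /weights size_interpolate ?E.
have Mt := marking_tetra sM t; split.
  move=> i j /(@mark_arc_inj _ _ Mt f); rewrite ixE !mem_nth // => /(_ isT isT)/eqP.
  by rewrite nth_uniq ?face_index_uniq // => /eqP/val_inj.
rewrite /arcs_of (face_arcsE Mt) ixE; apply/seteqP; split=> A.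
  by move=> [y /= /(nthP y0)[i iy <-] <-]; exists (Ordinal iy).
by move=> [i _ <-]; exists (nth y0 ix i) => //=; exact: mem_nth.
Qed.

End Isotopy.

(** * Invariance under isotopy *)

Section Invariance.
Local Open Scope ring_scope.
Local Open Scope classical_set_scope.
Local Open Scope card_scope.
Variables (R : realType) (n : nat) (T : gluing n).
Implicit Types (f a b c : 'I_4) (t : 'I_n) (s : R).
Implicit Types P Q : {P : {set 'I_4} | #|P| == 2}.

(** A continuous function which separates the open edge ab from all other open
    edges of the tetrahedron: on ab the product is positive and the other two
    terms vanish; on another edge the product vanishes and one of the other terms
    is positive. *)
Definition edge_sign f a b c (x : 'rV[R]_4) : R := x 0 a * x 0 b - x 0 f - x 0 c.

Lemma edge_sign_open f a b c P (x : 'rV[R]_4) : uniq [:: f; a; b; c] -> open_edge P x ->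
  if P == edge_of a b then 0 < edge_sign f a b c x else edge_sign f a b c x < 0.
Proof.
move=> u4; have := u4; rewrite uniq4E => /and5P[fa fb fc ab /andP[ac bc]].
case: eqVneq => [->|PE [[x0 _] pos]].
  move=> /(open_edgeP _ ab)[y y01 ->]; rewrite /edge_sign.
  have [-> -> -> ->] := edge_point_coords y u4; rewrite !subr0 mulr_gt0 //; lra.
have [d [e [de Pde]]] := edge_ofP P; subst P.
have zero i : i \notin val (edge_of d e) -> x 0 i = 0.
  by move=> ni; apply/eqP; rewrite eq_le x0 andbT leNgt pos.
have fcP : 0 < x 0 f + x 0 c.
  have [fP|fP] := boolP (f \in val (edge_of d e)).
    by rewrite -pos in fP; have := x0 c; lra.
  have [cP|cP] := boolP (c \in val (edge_of d e)).
    by rewrite -pos in cP; have := x0 f; lra.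
  exfalso; move: fP cP; rewrite !in_edge_of // !negb_or => /andP[fd fe] /andP[cd ce].
  move: PE; case: (uniq4_mem d u4) fd cd => dE; rewrite dE ?eqxx // => _ _;
  case: (uniq4_mem e u4) fe ce => eE; rewrite eE ?eqxx // => _ _;
  by move: de; rewrite dE eE ?eqxx // 1?(edge_ofC b) eqxx.
have abP : x 0 a * x 0 b = 0.
  have [aP|aP] := boolP (a \in val (edge_of d e)); last by rewrite (zero _ aP) mul0r.
  have [bP|bP] := boolP (b \in val (edge_of d e)); last by rewrite (zero _ bP) mulr0.
  exfalso; move: PE aP bP; rewrite !in_edge_of //.
  by move=> + /orP[]/eqP aE /orP[]/eqP bE; move: ab; rewrite aE bE ?eqxx // 1?(edge_ofC e) eqxx.
by rewrite /edge_sign abP; lra.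
Qed.

Lemma open_edge_inj P Q (x : 'rV[R]_4) : open_edge P x -> open_edge Q x -> P = Q.
Proof. by move=> [_ h] [_ h']; apply/val_inj/setP=> i; rewrite -h -h'. Qed.

(** Otherwise [edge_sign] would vanish somewhere on the path, by the intermediate
    value theorem. *)
Lemma path_open_edge (p : R -> 'rV[R]_4) a b : a != b ->
  {within `[0, 1], continuous p} ->
  (forall s, 0 <= s <= 1 -> exists P, open_edge P (p s)) ->
  open_edge (edge_of a b) (p 0) <-> open_edge (edge_of a b) (p 1).
Proof.
move=> ab cp edges; have [f [c u4]] := uniq4_edge ab.
(* The function h has no zero on the unit interval, and its sign tells whether
   the path is on the edge ab. *)
pose h := edge_sign f a b c \o p.
have ch : {within `[0, 1], continuous h}.
  apply: within_continuous_comp cp => x _.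
  have coord i : (fun y : 'rV[R]_4 => y 0 i) @ x --> x 0 i by exact: coord_continuous.
  exact: (cvgB (cvgB (cvgM (coord a) (coord b)) (coord f)) (coord c)).
have h_neq0 s : 0 <= s <= 1 -> h s != 0.
  move=> /edges[P /(edge_sign_open u4)]; rewrite -/(h s).
  by case: ifP => _; [move/gt_eqF ->|move/lt_eqF ->].
have hE s : 0 <= s <= 1 -> open_edge (edge_of a b) (p s) <-> 0 < h s.
  move=> /edges[P Ps]; have := edge_sign_open u4 Ps; rewrite -/(h s).
  case: ifP => [/eqP PE hs|/eqP ne hs]; first by split=> // _; rewrite -PE.
  by split=> [/(open_edge_inj Ps)//|h0]; have := lt_trans hs h0; rewrite ltxx.
have no_root : ~ (Num.min (h 0) (h 1) <= 0 <= Num.max (h 0) (h 1)).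
  by move=> /(IVT ler01 ch)[s]; rewrite in_itv /= => /h_neq0/eqP.
rewrite !hE ?lexx ?ler01 //; split=> hs; rewrite ltNge; apply/negP=> hs'; apply: no_root;
  by rewrite ge_min le_max hs' (ltW hs) ?orbT.
Qed.

Lemma normal_segment f (x y : 'rV[R]_4) : normal_arc f (segment x y) ->
  [/\ exists P, open_edge P x, exists P, open_edge P y, x <> y &
      forall z P, segment x y z -> open_edge P z -> z = x \/ z = y].
Proof.
move=> /normal_arcP[a [b [c [u [v [u4 u01 v01 E]]]]]].
have := u4; rewrite uniq4E => /and5P[fa fb fc ab /andP[ac bc]].
have eu : open_edge (edge_of a b) (edge_point a b u) by apply/(open_edgeP _ ab); exists u.
have ev : open_edge (edge_of a c) (edge_point a c v) by apply/(open_edgeP _ ac); exists v.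
have ne : edge_point a b u <> edge_point a c v.
  case/(edge_point_eq ab ac u01 v01) => -[/eqP + /eqP]; rewrite ?(negPf ab) //.
  by rewrite eq_sym (negPf bc).
have ends z P : segment x y z -> open_edge P z ->
    z = edge_point a b u \/ z = edge_point a c v.
  by rewrite E => zA; exact: corner_arc_open_edge u4 u01 v01 zA.
case: (segment_ends E) => -[xE yE]; rewrite xE yE in ends *; split=> //.
- by exists (edge_of a b).
- by exists (edge_of a c).
- by exists (edge_of a c).
- by exists (edge_of a b).
- exact/nesym.
- by move=> z P zA zP; case: (ends z P zA zP); auto.
Qed.

(** The ends of the moving arcs in a face at ab are indexed by a fixed set, and
    the subset of the ends on ab is the same at the times 0 and 1.  At both times
    it is in bijection with the points of intersection, because different arcs
    are disjoint and the two ends of an arc differ. *)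
Lemma isotopic_edge_card (S S' : arc_family n R) t a b : a != b ->
  normally_isotopic T S S' ->
  (\bigcup_(A in boundary_arcs S t) A) `&` open_edge (edge_of a b) #=
  (\bigcup_(A in boundary_arcs S' t) A) `&` open_edge (edge_of a b).
Proof.
move=> ab [H [H0 H1 Hsys Hpath]]; have [f [c u4]] := uniq4_edge ab.
have [k [p [q [pq_cont pqE]]]] := Hpath t f.
pose E s (z : 'I_k * bool) := if z.2 then p z.1 s else q z.1 s.
have normal s i : 0 <= s <= 1 -> normal_arc f (segment (p i s) (q i s)).
  move=> s01; have [sys _] := Hsys s s01; have [_ + _ _] := sys t f; apply.
  by have [_ ->] := pqE s s01; exists i.
pose Z := [set z | open_edge (edge_of a b) (E 0 z)].
have ZE s : s = 0 \/ s = 1 -> Z = [set z | open_edge (edge_of a b) (E s z)].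
  case=> -> //; rewrite /Z; apply/seteqP; split=> -[i d] /= h;
  apply/(path_open_edge (p := fun s => E s (i, d)) ab) => //;
  rewrite /E /=; case: d h => _; try (by have [] := pq_cont i);
  by move=> s' /(normal _ i)/normal_segment[].
have card s : s = 0 \/ s = 1 ->
    (\bigcup_(A in boundary_arcs (H s) t) A) `&` open_edge (edge_of a b) #= Z.
  move=> s_end; have s01 : 0 <= s <= 1 by case: s_end => ->; lra.
  have [sys cyc] := Hsys s s01; have [seg_inj HE] := pqE s s01.
  have -> : (\bigcup_(A in boundary_arcs (H s) t) A) `&` open_edge (edge_of a b) = E s @` Z.
    rewrite (ZE s s_end); apply/seteqP; split=> x.
      move=> [xA xab]; have [y y01 xE] := (open_edgeP _ ab).1 xab.
      have /(edge_setP sys cyc _ _ u4)[_ [A]] : edge_set (H s) t a b y.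
        by split; rewrite // -xE.
      rewrite HE -xE => -[i _ <-] Ax; have [_ _ _ ends] := normal_segment (normal s i s01).
      by case: (ends x _ Ax xab) => xE'; [exists (i, true)|exists (i, false)];
        rewrite /E //= -xE'.
    move=> [[i d] /= zab <-]; split=> //; exists (segment (p i s) (q i s)).
      by exists f => //; rewrite HE; exists i.
    by rewrite /E /=; case: (d); [exact: segmentl|exact: segmentr].
  apply: inj_card_eq => -[i d] [j e] _ _ Eij.
  have onA i' d' : segment (p i' s) (q i' s) (E s (i', d')).
    by rewrite /E /=; case: d'; [exact: segmentl|exact: segmentr].
  have ij : i = j.
    apply: seg_inj; apply: (system_disj sys (t := t) (f := f)).
    + by rewrite HE; exists i.
    + by rewrite HE; exists j.
    + by exists (E s (i, d)); split; [exact: onA|rewrite Eij; exact: onA].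
  subst j; congr (_, _); have [_ _ ne _] := normal_segment (normal s i s01).
  by move: Eij; rewrite /E /=; case: d; case: e => // Epq; case: ne; rewrite Epq.
have C0 := card 0 (or_introl erefl); have C1 := card 1 (or_intror erefl).
by rewrite H0 in C0; rewrite H1 in C1; apply: card_eq_trans C0 (card_esym C1).
Qed.

End Invariance.

(** * Admissible colourings and closed systems of arcs *)

Theorem theorem7 (R : realType) (M : topologicalType)
    (hM : closed_manifold R 3 M) (n : nat) (T : gluing n)
    (hT : triangulates T R M) (r : nat) (hr : (3 <= r)%N) :
  (forall theta : colouring T r, admissible theta ->
     exists S : arc_family n R,
       cyclic_arc_system T (r - 2) S /\ corresponds theta S) /\
  (forall S : arc_family n R, cyclic_arc_system T (r - 2) S ->
     exists! theta : colouring T r, admissible theta /\ corresponds theta S) /\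
  (forall (S S' : arc_family n R) (theta theta' : colouring T r),
     cyclic_arc_system T (r - 2) S -> cyclic_arc_system T (r - 2) S' ->
     admissible theta -> admissible theta' ->
     corresponds theta S -> corresponds theta' S' ->
     (theta = theta' <-> normally_isotopic T S S')).
Proof.
split; [|split].
- exact: colouring_has_arcs.
- move=> S [sys most cyc]; have posM := system_marking sys cyc.
  have SE := system_arcs_of sys cyc; rewrite {}SE in most *.
  have [theta wE] := marking_colouring (ltnW hr) posM most.
  exists theta; split.
    by split; [exact/(marking_admissible posM wE)|exact/(corresponds_arcs_of _ posM)].
  move=> theta' [_ /(corresponds_arcs_of _ posM) wE'].
  apply: colouring_eq => t a b ab; apply: (mulfI (_ : 2 != 0 :> rat)%R) => //.
  by rewrite wE // wE'.
move=> S S' theta theta' [sys _ cyc] [sys' _ cyc'] _ _ cS cS'; split.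
  move=> E; subst theta'.
  have posM := system_marking sys cyc; have posM' := system_marking sys' cyc'.
  rewrite (system_arcs_of sys cyc) in cS *; rewrite (system_arcs_of sys' cyc') in cS' *.
  apply: interpolate_isotopic => // t a b ab; apply/eqP.
  move: cS cS' => /(corresponds_arcs_of _ posM) cS /(corresponds_arcs_of _ posM') cS'.
  by rewrite -(@Num.Theory.eqr_nat rat) -cS // cS'.
move=> iso; apply: colouring_eq => t a b ab.
have [k [E C]] := cS t (edge_of a b); have [k' [E' C']] := cS' t (edge_of a b).
apply: (mulfI (_ : 2 != 0 :> rat)%R) => //; rewrite E E'.
suff -> : k = k' by [].
apply/card_eq_II; apply: card_eq_trans (card_esym C) _.
exact: card_eq_trans (isotopic_edge_card t ab iso) C'.
Qed.
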